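(* Let $\mathfrak{g}$ be a finite dimensional $p$-step nilpotent Lie algebra over a field $k$ with free $p$-step nilpotent extension $$0\to\mathfrak{n}\to\mathfrak{f}_{n,p}\xrightarrow{\pi}\mathfrak{g}\to0.$$ Then $\mathfrak{g}$ admits a central extension of class $p+1$ if and only if $$\dim_k\frac{\mathfrak{n}}{[\mathfrak{f}_{n,p},\mathfrak{n}]}<b_2(\mathfrak{g}).$$ In particular, if $\mathfrak{n}$ is generated (as an ideal of $\mathfrak{f}_{n,p}$) by a single element $X\in[\mathfrak{f}_{n,p},\mathfrak{f}_{n,p}]$, then $\mathfrak{g}$ admits a central extension of class $p+1$.
   Context: The field $k$ is arbitrary, and $b_2(\mathfrak{g})=\dim_k\mathrm{H}^2(\mathfrak{g},k)$ with trivial coefficients. The lower central series is $\mathfrak{g}^1=\mathfrak{g}$, $\mathfrak{g}^{i+1}=[\mathfrak{g},\mathfrak{g}^i]$; $\mathfrak{g}$ is $p$-step nilpotent ($p\ge1$), or nilpotent of class $p$, if $\mathfrak{g}^p\neq0$ and $\mathfrak{g}^{p+1}=0$. A central extension of $\mathfrak{g}$ of class $p+1$ is a short exact sequence of finite dimensional Lie algebras $0\to M\to\mathfrak{e}\to\mathfrak{g}\to0$ where $M$ is contained in the center of $\mathfrak{e}$ and $\mathfrak{e}$ is $(p+1)$-step nilpotent. Let $n=\dim_k\mathfrak{g}/[\mathfrak{g},\mathfrak{g}]$ and let $\mathfrak{f}_{n,p}=\mathfrak{f}_n/\mathfrak{f}_n^{p+1}$ be the free $p$-step nilpotent Lie algebra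 on $n$ generators, where $\mathfrak{f}_n$ is the free Lie algebra over $k$ on $n$ generators. A free $p$-step nilpotent extension of $\mathfrak{g}$ is a short exact sequence of Lie algebras $0\to\mathfrak{n}\to\mathfrak{f}_{n,p}\xrightarrow{\pi}\mathfrak{g}\to0$ with $\mathfrak{n}\subset[\mathfrak{f}_{n,p},\mathfrak{f}_{n,p}]$.
   Formalization: The ''in particular'' clause is stated for dim g ≠ 1; for dim g = 1 it fails: then p = n = 1, the ideal n = 0 is generated by X = 0, and every central extension of a one-dimensional Lie algebra is abelian, so none has class 2. *)

(* Defs.v *)
From HB Require Import structures.
From mathcomp Require Import all_boot all_order all_algebra.
From mathcomp Require Import boolp classical_sets.

Set Implicit Arguments.
Unset Strict Implicit.
Unset Printing Implicit Defensive.

Import GRing.Theory.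
Local Open Scope ring_scope.
Local Open Scope quotient_scope.
Local Open Scope classical_set_scope.

Reserved Notation "[< x , y >]" (at level 0, x, y at level 99,
  format "[<  x ,  y  >]").

HB.mixin Record isLie (k : fieldType) L of GRing.Lmodule k L := {
  lie : L -> L -> L;
  lie_linearl : forall (a : k) x y z,
    lie (a *: x + y) z = a *: lie x z + lie y z;
  lie_linearr : forall (a : k) x y z,
    lie z (a *: x + y) = a *: lie z x + lie z y;
  liexx : forall x, lie x x = 0;
  lie_jacobi : forall x y z,
    lie x (lie y z) + lie y (lie z x) + lie z (lie x y) = 0
}.

#[short(type="lieType")]
HB.structure Definition Lie (k : fieldType) :=
  { L of GRing.Lmodule k L & isLie k L }.

#[short(type="finLieType")]
HB.structure Definition FinLie (k : fieldType) :=
  { L of Vector k L & isLie k L }.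

Notation "[< x , y >]" := (lie x y) : ring_scope.

Definition lie_morph (k : fieldType) (L1 L2 : lieType k) (f : L1 -> L2) :=
  forall x y, f [< x, y >] = [< f x, f y >].

Section LieTheory.
Variables (k : fieldType) (L : lieType k).
Implicit Types (x y z : L) (A B : set L).

Lemma lieDl x y z : [< x + y, z >] = [< x, z >] + [< y, z >].
Proof. by rewrite -[x]scale1r lie_linearl !scale1r. Qed.

Lemma lieDr x y z : [< z, x + y >] = [< z, x >] + [< z, y >].
Proof. by rewrite -[x]scale1r lie_linearr !scale1r. Qed.

Lemma lie0r x : [< 0, x >] = 0.
Proof. by apply: (addrI [< 0, x >]); rewrite -lieDl !addr0. Qed.

Lemma lier0 x : [< x, 0 >] = 0.
Proof. by apply: (addrI [< x, 0 >]); rewrite -lieDr !addr0. Qed.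

Lemma lieZl a x y : [< a *: x, y >] = a *: [< x, y >].
Proof. by rewrite -[a *: x]addr0 lie_linearl lie0r addr0. Qed.

Lemma lieZr a x y : [< x, a *: y >] = a *: [< x, y >].
Proof. by rewrite -[a *: y]addr0 lie_linearr lier0 addr0. Qed.

Lemma lieNl x y : [< - x, y >] = - [< x, y >].
Proof. by rewrite -scaleN1r lieZl scaleN1r. Qed.

Lemma lieNr x y : [< x, - y >] = - [< x, y >].
Proof. by rewrite -scaleN1r lieZr scaleN1r. Qed.

Lemma lieC x y : [< x, y >] = - [< y, x >].
Proof.
apply/eqP; rewrite -addr_eq0; apply/eqP.
by have := liexx (x + y); rewrite lieDl !lieDr !liexx add0r addr0.
Qed.

Lemma lie_leibniz x y z :
  [< [< x, y >], z >] = [< x, [< y, z >] >] - [< y, [< x, z >] >].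
Proof.
have /eqP := lie_jacobi x y z; rewrite (lieC z x) lieNr (lieC z).
by rewrite subr_eq0 => /eqP.
Qed.

Definition submod (V : lmodType k) (A : set V) :=
  A 0 /\ forall (a : k) (x y : V), A x -> A y -> A (a *: x + y).

Definition lie_ideal A := submod A /\ forall x y, A y -> A [< x, y >].

Definition lie_center : set L := [set x | forall y, [< x, y >] = 0].

(* As usual, the product of two subspaces is the span of the brackets. *)
Definition lie_prod A B : set L :=
  smallest (@submod L) [set [< x, y >] | x in A & y in B].

Definition ideal_gen A : set L := smallest lie_ideal A.

(* The lower central series is numbered from 1: [lcs 1] is the whole algebra,
   and [lcs 0] is a junk value. *)
Definition lcs i : set L := iter i.-1 (lie_prod setT) setT.

Definition nilpotent_class p :=
  [/\ (0 < p)%N, lcs p <> [set 0] & lcs p.+1 = [set 0]].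

End LieTheory.

Arguments lie_center {k} L.
Arguments lcs {k} L i.
Arguments nilpotent_class {k} L p.

Section SubmodTheory.
Variables (k : fieldType) (V : lmodType k).

Lemma submodD (A : set V) x y : submod A -> A x -> A y -> A (x + y).
Proof. by case=> _ AL Ax Ay; rewrite -[x]scale1r; apply: AL. Qed.

Lemma submodZ (A : set V) a x : submod A -> A x -> A (a *: x).
Proof. by case=> A0 AL Ax; rewrite -[_ *: _]addr0; apply: AL. Qed.

Lemma submodB (A : set V) x y : submod A -> A x -> A y -> A (x - y).
Proof.
by case=> _ AL Ax Ay; rewrite addrC -scaleN1r; apply: AL.
Qed.

Lemma submodT : submod (@setT V). Proof. by split. Qed.

Lemma submod_smallest (A : set V) : submod (smallest (@submod k V) A).
Proof.
split=> [B [[B0 _] _] //|a x y Ax Ay B [BS AB]].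
by case: (BS) => _; apply; [apply: Ax | apply: Ay].
Qed.

End SubmodTheory.

Section LcsTheory.
Variables (k : fieldType) (L : lieType k).

Lemma lcsS i : lcs L i.+2 = lie_prod setT (lcs L i.+1).
Proof. by []. Qed.

Lemma submod_lcs i : submod (lcs L i).
Proof. by case: i => [|[|i]]; [exact: submodT..|exact: submod_smallest]. Qed.

Lemma lcs_lie i x y : lcs L i.+1 y -> lcs L i.+2 [< x, y >].
Proof. by move=> ?; apply: sub_gen_smallest; exists x => //; exists y. Qed.

Lemma lcs_desc i : lcs L i.+2 `<=` lcs L i.+1.
Proof.
elim: i => [//|i IH]; apply: smallest_sub; first exact: submod_lcs.
by move=> _ [x _ [y /IH Ly <-]]; exact: lcs_lie.
Qed.

Lemma lcs_ideal i : lie_ideal (lcs L i).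
Proof.
split; first exact: submod_lcs.
by case: i => [|i] x y Ly; [exact: I|apply: lcs_desc; exact: lcs_lie].
Qed.

Lemma lcs2_lie i x y : lcs L 2 x -> lcs L i.+1 y -> lcs L i.+3 [< x, y >].
Proof.
move=> Lx Ly; move: x Lx; apply: smallest_sub.
  split=> [|a u v Lu Lv]; first by rewrite /= lie0r; case: (submod_lcs i.+3).
  by rewrite lie_linearl; case: (submod_lcs i.+3) => _; apply.
move=> _ [u _ [v _ <-]]; rewrite lie_leibniz.
by apply: (submodB (submod_lcs _)); do 2!apply: lcs_lie.
Qed.

End LcsTheory.

Record lieIdeal (k : fieldType) (L : lieType k) := LieIdeal {
  ideal_set : set L;
  ideal_setP : lie_ideal ideal_set }.

Section LieQuotient.
Variables (k : fieldType) (L : lieType k) (I : lieIdeal L).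
Implicit Types x y z : L.

Let subI : submod (ideal_set I) := (ideal_setP I).1.

Definition modI x y : bool := `[< ideal_set I (x - y) >].

Fact modI_equiv : equiv_class_of modI.
Proof.
split=> [x|x y|y x z].
- by apply/asboolP; rewrite subrr; case: subI.
- by apply: asbool_equiv_eq; split=> /(submodZ (-1) subI);
    rewrite scaleN1r opprB.
- move=> /asboolP xy /asboolP yz; apply/asboolP.
  by have := submodD subI xy yz; rewrite addrA subrK.
Qed.

Canonical modI_equivrel := EquivRelPack modI_equiv.
Canonical modI_encModRel := defaultEncModRel modI.

Definition lieQuot := {eq_quot modI}.
HB.instance Definition _ := Choice.on lieQuot.
HB.instance Definition _ := EqQuotient.on lieQuot.

Definition to_quot x : lieQuot := \pi x.

Lemma to_quotE x y : to_quot x = to_quot y <-> ideal_set I (x - y).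
Proof.
rewrite /to_quot; split=> [/eqP|xy].
  by rewrite eqmodE => /asboolP.
by apply/eqP; rewrite eqmodE; apply/asboolP.
Qed.

Lemma to_quotP (u : lieQuot) : exists x, u = to_quot x.
Proof. by exists (repr u); rewrite /to_quot reprK. Qed.

Lemma repr_quotI x : ideal_set I (repr (to_quot x) - x).
Proof. by apply/to_quotE; rewrite /to_quot reprK. Qed.

Let q0 := to_quot 0.
Let qadd (u v : lieQuot) := to_quot (repr u + repr v).
Let qopp (u : lieQuot) := to_quot (- repr u).
Let qscale (a : k) (u : lieQuot) := to_quot (a *: repr u).
Let qlie (u v : lieQuot) := to_quot [< repr u, repr v >].

Let qaddE x y : qadd (to_quot x) (to_quot y) = to_quot (x + y).
Proof.
apply/to_quotE; rewrite opprD addrACA.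
by apply: (submodD subI); exact: repr_quotI.
Qed.

Let qscaleE a x : qscale a (to_quot x) = to_quot (a *: x).
Proof.
by apply/to_quotE; rewrite -scalerBr; apply: (submodZ _ subI); apply: repr_quotI.
Qed.

Let qoppE x : qopp (to_quot x) = to_quot (- x).
Proof. by rewrite -[- x]scaleN1r -qscaleE /qopp /qscale scaleN1r. Qed.

Let qlieE x y : qlie (to_quot x) (to_quot y) = to_quot [< x, y >].
Proof.
apply/to_quotE; set x' := repr _; set y' := repr _.
have -> : [< x', y' >] - [< x, y >] = [< x', y' - y >] - [< y, x' - x >].
  by rewrite !lieDr !lieNr (lieC y x') (lieC y x) opprD !opprK addrA subrK.
have idI := (ideal_setP I).2.
by apply: (submodB subI); apply/idI/repr_quotI.
Qed.

Let qaddA : associative qadd.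
Proof.
move=> u v w; have [x ->] := to_quotP u; have [y ->] := to_quotP v.
by have [z ->] := to_quotP w; rewrite !qaddE addrA.
Qed.

Let qaddC : commutative qadd.
Proof.
move=> u v; have [x ->] := to_quotP u; have [y ->] := to_quotP v.
by rewrite !qaddE addrC.
Qed.

Let qadd0 : left_id q0 qadd.
Proof. by move=> u; have [x ->] := to_quotP u; rewrite !qaddE add0r. Qed.

Let qaddN : left_inverse q0 qopp qadd.
Proof. by move=> u; have [x ->] := to_quotP u; rewrite qoppE qaddE addNr. Qed.

HB.instance Definition _ :=
  GRing.isZmodule.Build lieQuot qaddA qaddC qadd0 qaddN.

Let qscaleA a b u : qscale a (qscale b u) = qscale (a * b) u.
Proof. by have [x ->] := to_quotP u; rewrite !qscaleE scalerA. Qed.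

Let qscale1 : left_id 1 qscale.
Proof. by move=> u; have [x ->] := to_quotP u; rewrite qscaleE scale1r. Qed.

Let qscaleDr : right_distributive qscale +%R.
Proof.
move=> a u v; have [x ->] := to_quotP u; have [y ->] := to_quotP v.
rewrite -[LHS]/(qscale a (qadd _ _)) -[RHS]/(qadd (qscale _ _) (qscale _ _)).
by rewrite qaddE !qscaleE qaddE scalerDr.
Qed.

Let qscaleDl u : {morph qscale^~ u : a b / a + b}.
Proof.
move=> a b; have [x ->] := to_quotP u.
rewrite -[RHS]/(qadd (qscale _ _) (qscale _ _)).
by rewrite !qscaleE qaddE scalerDl.
Qed.

HB.instance Definition _ := GRing.Zmodule_isLmodule.Build k lieQuot
  qscaleA qscale1 qscaleDr qscaleDl.

Fact to_quot_linear : linear to_quot.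
Proof. by move=> a x y; rewrite -qaddE -qscaleE. Qed.
HB.instance Definition _ :=
  GRing.isLinear.Build k L lieQuot _ to_quot to_quot_linear.

Let qlie_linearl a u v w : qlie (a *: u + v) w = a *: qlie u w + qlie v w.
Proof.
have [x ->] := to_quotP u; have [y ->] := to_quotP v.
have [z ->] := to_quotP w.
by rewrite -linearP !qlieE lie_linearl linearP.
Qed.

Let qlie_linearr a u v w : qlie w (a *: u + v) = a *: qlie w u + qlie w v.
Proof.
have [x ->] := to_quotP u; have [y ->] := to_quotP v.
have [z ->] := to_quotP w.
by rewrite -linearP !qlieE lie_linearr linearP.
Qed.

Let qliexx u : qlie u u = 0.
Proof. by have [x ->] := to_quotP u; rewrite qlieE liexx linear0. Qed.

Let qlie_jacobi u v w :
  qlie u (qlie v w) + qlie v (qlie w u) + qlie w (qlie u v) = 0.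
Proof.
have [x ->] := to_quotP u; have [y ->] := to_quotP v.
have [z ->] := to_quotP w.
have := congr1 to_quot (lie_jacobi x y z).
by rewrite !linearD linear0 !qlieE.
Qed.

HB.instance Definition _ := isLie.Build k lieQuot
  qlie_linearl qlie_linearr qliexx qlie_jacobi.

Lemma to_quot_lie : lie_morph to_quot.
Proof. by move=> x y; rewrite -qlieE. Qed.

Lemma to_quot_eq0 x : to_quot x = 0 <-> ideal_set I x.
Proof. by rewrite -(linear0 to_quot) to_quotE subr0. Qed.

End LieQuotient.

(* Formal Lie expressions, modulo the congruence generated by the axioms of
   Lie algebras. *)
Inductive lieTerm (k : fieldType) (n : nat) : Type :=
| LVar of 'I_n
| LZero
| LAdd of lieTerm k n & lieTerm k n
| LScale of k & lieTerm k n
| LLie of lieTerm k n & lieTerm k n.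

Arguments LVar k {n} _.
Arguments LZero {k n}.

HB.instance Definition _ (k : fieldType) n := gen_eqMixin (lieTerm k n).
HB.instance Definition _ (k : fieldType) n := gen_choiceMixin (lieTerm k n).

Inductive lieEq (k : fieldType) (n : nat) :
  lieTerm k n -> lieTerm k n -> Prop :=
| LErefl s : lieEq s s
| LEsym s t : lieEq s t -> lieEq t s
| LEtrans s t u : lieEq s t -> lieEq t u -> lieEq s u
| LEadd s s' t t' : lieEq s s' -> lieEq t t' -> lieEq (LAdd s t) (LAdd s' t')
| LEscale a s s' : lieEq s s' -> lieEq (LScale a s) (LScale a s')
| LElie s s' t t' : lieEq s s' -> lieEq t t' -> lieEq (LLie s t) (LLie s' t')
| LEaddA s t u : lieEq (LAdd s (LAdd t u)) (LAdd (LAdd s t) u)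
| LEaddC s t : lieEq (LAdd s t) (LAdd t s)
| LEadd0 s : lieEq (LAdd LZero s) s
| LEaddN s : lieEq (LAdd (LScale (-1) s) s) LZero
| LEscaleA a b s : lieEq (LScale a (LScale b s)) (LScale (a * b) s)
| LEscale1 s : lieEq (LScale 1 s) s
| LEscaleDr a s t :
    lieEq (LScale a (LAdd s t)) (LAdd (LScale a s) (LScale a t))
| LEscaleDl a b s :
    lieEq (LScale (a + b) s) (LAdd (LScale a s) (LScale b s))
| LElinearl a s t u : lieEq (LLie (LAdd (LScale a s) t) u)
                            (LAdd (LScale a (LLie s u)) (LLie t u))
| LElinearr a s t u : lieEq (LLie u (LAdd (LScale a s) t))
                            (LAdd (LScale a (LLie u s)) (LLie u t))
| LExx s : lieEq (LLie s s) LZero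
| LEjacobi s t u :
    lieEq (LAdd (LAdd (LLie s (LLie t u)) (LLie t (LLie u s)))
                (LLie u (LLie s t))) LZero.

Section FreeLie.
Variables (k : fieldType) (n : nat).
Local Notation term := (lieTerm k n).
Implicit Types s t : term.

Definition lieEqb s t : bool := `[< lieEq s t >].

Fact lieEqb_equiv : equiv_class_of lieEqb.
Proof.
split=> [s|s t|t s u].
- by apply/asboolP; exact: LErefl.
- by apply: asbool_equiv_eq; split=> ?; exact: LEsym.
- by move=> /asboolP st /asboolP tu; apply/asboolP; exact: LEtrans tu.
Qed.

Canonical lieEqb_equivrel := EquivRelPack lieEqb_equiv.
Canonical lieEqb_encModRel := defaultEncModRel lieEqb.

Definition freeLie := {eq_quot lieEqb}.
HB.instance Definition _ := Choice.on freeLie.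
HB.instance Definition _ := EqQuotient.on freeLie.

Let cl t : freeLie := \pi t.

Let clE s t : cl s = cl t <-> lieEq s t.
Proof.
rewrite /cl; split=> [/eqP|st].
  by rewrite eqmodE => /asboolP.
by apply/eqP; rewrite eqmodE; apply/asboolP.
Qed.

Let clP (u : freeLie) : exists t, u = cl t.
Proof. by exists (repr u); rewrite /cl reprK. Qed.

Let repr_cl t : lieEq (repr (cl t)) t.
Proof. by apply/clE; rewrite /cl reprK. Qed.

Let f0 : freeLie := cl LZero.
Let fadd (u v : freeLie) := cl (LAdd (repr u) (repr v)).
Let fscale (a : k) (u : freeLie) := cl (LScale a (repr u)).
Let flie (u v : freeLie) := cl (LLie (repr u) (repr v)).

Let faddE s t : fadd (cl s) (cl t) = cl (LAdd s t).
Proof. by apply/clE/LEadd; exact: repr_cl. Qed.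

Let fscaleE a t : fscale a (cl t) = cl (LScale a t).
Proof. by apply/clE/LEscale; exact: repr_cl. Qed.

Let flieE s t : flie (cl s) (cl t) = cl (LLie s t).
Proof. by apply/clE/LElie; exact: repr_cl. Qed.

Let faddA : associative fadd.
Proof.
move=> u v w; have [s ->] := clP u; have [t ->] := clP v.
by have [r ->] := clP w; rewrite !faddE; apply/clE/LEaddA.
Qed.

Let faddC : commutative fadd.
Proof.
move=> u v; have [s ->] := clP u; have [t ->] := clP v.
by rewrite !faddE; apply/clE/LEaddC.
Qed.

Let fadd0 : left_id f0 fadd.
Proof. by move=> u; have [s ->] := clP u; rewrite faddE; apply/clE/LEadd0. Qed.

Let faddN : left_inverse f0 (fscale (-1)) fadd.
Proof.
by move=> u; have [s ->] := clP u; rewrite fscaleE faddE; apply/clE/LEaddN.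
Qed.

HB.instance Definition _ :=
  GRing.isZmodule.Build freeLie faddA faddC fadd0 faddN.

Let fscaleA a b u : fscale a (fscale b u) = fscale (a * b) u.
Proof. by have [s ->] := clP u; rewrite !fscaleE; apply/clE/LEscaleA. Qed.

Let fscale1 : left_id 1 fscale.
Proof.
by move=> u; have [s ->] := clP u; rewrite fscaleE; apply/clE/LEscale1.
Qed.

Let fscaleDr : right_distributive fscale +%R.
Proof.
move=> a u v; have [s ->] := clP u; have [t ->] := clP v.
rewrite -[LHS]/(fscale a (fadd _ _)) -[RHS]/(fadd (fscale _ _) (fscale _ _)).
by rewrite faddE !fscaleE faddE; apply/clE/LEscaleDr.
Qed.

Let fscaleDl u : {morph fscale^~ u : a b / a + b}.
Proof.
move=> a b; have [s ->] := clP u.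
rewrite -[RHS]/(fadd (fscale _ _) (fscale _ _)).
by rewrite !fscaleE faddE; apply/clE/LEscaleDl.
Qed.

HB.instance Definition _ := GRing.Zmodule_isLmodule.Build k freeLie
  fscaleA fscale1 fscaleDr fscaleDl.

Let flie_linearl a u v w : flie (a *: u + v) w = a *: flie u w + flie v w.
Proof.
have [s ->] := clP u; have [t ->] := clP v; have [r ->] := clP w.
rewrite -[LHS]/(flie (fadd (fscale a _) _) _) -[RHS]/(fadd (fscale a _) _).
by rewrite !(fscaleE, faddE, flieE); apply/clE/LElinearl.
Qed.

Let flie_linearr a u v w : flie w (a *: u + v) = a *: flie w u + flie w v.
Proof.
have [s ->] := clP u; have [t ->] := clP v; have [r ->] := clP w.
rewrite -[LHS]/(flie _ (fadd (fscale a _) _)) -[RHS]/(fadd (fscale a _) _).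
by rewrite !(fscaleE, faddE, flieE); apply/clE/LElinearr.
Qed.

Let fliexx u : flie u u = 0.
Proof. by have [s ->] := clP u; rewrite flieE; apply/clE/LExx. Qed.

Let flie_jacobi u v w :
  flie u (flie v w) + flie v (flie w u) + flie w (flie u v) = 0.
Proof.
have [s ->] := clP u; have [t ->] := clP v; have [r ->] := clP w.
rewrite -[LHS]/(fadd (fadd _ _) _).
by rewrite !(faddE, flieE); apply/clE/LEjacobi.
Qed.

HB.instance Definition _ := isLie.Build k freeLie
  flie_linearl flie_linearr fliexx flie_jacobi.

Definition free_gen (i : 'I_n) : freeLie := cl (LVar k i).

Lemma freeLie_ind (P : freeLie -> Prop) :
  (forall i, P (free_gen i)) -> submod P ->
  (forall x y, P x -> P y -> P [< x, y >]) -> forall x, P x.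
Proof.
move=> Pg Ps Pl x; have [t ->] := clP x.
elim: t => [i||s Ps' t Pt|a s Ps'|s Ps' t Pt].
- exact: Pg.
- by case: Ps.
- by rewrite -faddE; apply: (submodD Ps).
- by rewrite -fscaleE; apply: (submodZ _ Ps).
- by rewrite -flieE; apply: Pl.
Qed.

Section Universal.
Variables (L : lieType k) (y : 'I_n -> L).

Fixpoint lie_eval (t : term) : L :=
  match t with
  | LVar i => y i
  | LZero => 0
  | LAdd s t => lie_eval s + lie_eval t
  | LScale a s => a *: lie_eval s
  | LLie s t => [< lie_eval s, lie_eval t >]
  end.

Lemma lie_eval_eq s t : lieEq s t -> lie_eval s = lie_eval t.
Proof.
elim=> //=; clear.
- by move=> s t u _ -> _ ->.
- by move=> s s' t t' _ -> _ ->.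
- by move=> a s s' _ ->.
- by move=> s s' t t' _ -> _ ->.
- by move=> *; rewrite addrA.
- by move=> *; rewrite addrC.
- by move=> *; rewrite add0r.
- by move=> *; rewrite scaleN1r addNr.
- by move=> *; rewrite scalerA.
- by move=> *; rewrite scale1r.
- by move=> *; rewrite scalerDr.
- by move=> *; rewrite scalerDl.
- by move=> *; rewrite lie_linearl.
- by move=> *; rewrite lie_linearr.
- by move=> *; rewrite liexx.
- by move=> *; rewrite lie_jacobi.
Qed.

Definition free_lift (u : freeLie) : L := lie_eval (repr u).

Let liftE t : free_lift (cl t) = lie_eval t.
Proof. exact/lie_eval_eq/repr_cl. Qed.

Fact free_lift_linear : linear free_lift.
Proof.
move=> a u v; have [s ->] := clP u; have [t ->] := clP v.
rewrite -[a *: _ + _]/(fadd (fscale a _) _).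
by rewrite fscaleE faddE !liftE.
Qed.
HB.instance Definition _ :=
  GRing.isLinear.Build k freeLie L _ free_lift free_lift_linear.

Lemma free_lift_lie : lie_morph free_lift.
Proof.
move=> u v; have [s ->] := clP u; have [t ->] := clP v.
by rewrite -[[< _, _ >]]/(flie _ _) flieE !liftE.
Qed.

Lemma free_lift_gen i : free_lift (free_gen i) = y i.
Proof. exact: liftE. Qed.

Lemma free_lift_uniq (f : {linear freeLie -> L}) :
  lie_morph f -> (forall i, f (free_gen i) = y i) -> f =1 free_lift.
Proof.
move=> fl fg; apply: freeLie_ind => [i||u v fu fv].
- by rewrite fg free_lift_gen.
- split=> [|a u v fu fv]; first by rewrite !linear0.
  by rewrite !linearP fu fv.
- by rewrite fl free_lift_lie fu fv.
Qed.

End Universal.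

End FreeLie.

Section FinSpan.
Variables (k : fieldType) (V : lmodType k).

Definition comb (s : seq V) (c : 'rV[k]_(size s)) : V :=
  \sum_(i < size s) c 0 i *: s`_i.

Fact comb_linear s : linear (@comb s).
Proof.
move=> a c d; rewrite /comb scaler_sumr -big_split /=.
by apply: eq_bigr => i _; rewrite !mxE scalerDl scalerA.
Qed.
HB.instance Definition _ s :=
  GRing.isLinear.Build k 'rV[k]_(size s) V _ (@comb s) (@comb_linear s).

Definition lspan (s : seq V) : set V := range (@comb s).

Lemma submod_lspan s : submod (lspan s).
Proof.
split; first by exists 0 => //; rewrite linear0.
by move=> a _ _ [c _ <-] [d _ <-]; exists (a *: c + d); rewrite // linearP.
Qed.

Lemma mem_lspan (s : seq V) x : x \in s -> lspan s x.
Proof.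
move=> xs; have lt : (index x s < size s)%N by rewrite index_mem.
exists (delta_mx 0 (Ordinal lt)) => //.
rewrite /comb (bigD1 (Ordinal lt)) //= mxE !eqxx scale1r nth_index //.
rewrite big1 ?addr0 // => i /negPf ni; rewrite mxE eqxx /=.
by rewrite ni scale0r.
Qed.

Lemma lspan_sub (A : set V) s :
  submod A -> (forall x, x \in s -> A x) -> lspan s `<=` A.
Proof.
move=> sA As _ [c _ <-]; rewrite /comb.
elim/big_ind: _ => [||i _]; first by case: sA.
  by move=> x y; apply: (submodD sA).
by apply/(submodZ _ sA)/As/mem_nth.
Qed.

(* A shortest spanning list is a basis. *)
Lemma fin_span_vector (s : seq V) :
  lspan s = setT -> exists d, inhabited (Vector.axiom d V).
Proof.
move=> spans.
pose P d := `[< exists2 s : seq V, size s = d & lspan s = setT >].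
have exP : exists d, P d by exists (size s); apply/asboolP; exists s.
case: (ex_minnP exP) => d /asboolP[t szt spant] mint.
have inj : injective (@comb t).
  apply: raddf_inj => c /eqP c0; apply/eqP; apply: contraT => cn0.
  have [i cin0] : exists i, c 0 i != 0.
    apply/existsP; apply: contraNT cn0; rewrite negb_exists => /forallP c0'.
    by apply/eqP/rowP => i; rewrite mxE; apply/eqP/negPn/c0'.
  pose t' := [seq t`_j | j : 'I_(size t) <- rem i (enum 'I_(size t))].
  have szt' : size t' = (size t).-1.
    by rewrite size_map size_rem ?mem_enum // size_enum_ord.
  have other j : j != i -> lspan t' t`_j.
    move=> ji; apply: mem_lspan; apply: (map_f (fun j : 'I_(size t) => t`_j)).
    by rewrite mem_rem_uniq ?enum_uniq // inE ji mem_enum.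
  have lti : lspan t' t`_i.
    have -> : t`_i = - (c 0 i)^-1 *: \sum_(j < size t | j != i) c 0 j *: t`_j.
      have e : c 0 i *: t`_i = - \sum_(j < size t | j != i) c 0 j *: t`_j.
        by have : comb c == 0 := c0; rewrite {1}/comb (bigD1 i) //= addr_eq0 => /eqP.
      by rewrite scaleNr -scalerN -e scalerA mulVf // scale1r.
    have sT := submod_lspan t'; apply/(submodZ _ sT)/(big_ind (lspan t')).
    - by case: sT.
    - by move=> x y; exact: (submodD sT).
    - by move=> j /other; exact: (submodZ _ sT).
  have /mint : P (size t').
    apply/asboolP; exists t' => //; apply/seteqP; split=> // x _.
    have : lspan t x by rewrite spant.
    apply: lspan_sub; first exact: submod_lspan.
    move=> y /(nthP 0)[j jt <-].
    by case: (eqVneq (Ordinal jt) i) => [e|/other//]; rewrite -e in lti.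
  have := leq_ltn_trans (leq0n i) (ltn_ord i); rewrite szt' -szt.
  by case: (size t) => // m _; rewrite ltnn.
have surj (x : V) : exists c, @comb t c = x.
  by have : lspan t x by [rewrite spant]; case=> c _ <-; exists c.
have [g gK] := choice surj.
exists (size t); constructor; exists g.
  by move=> a x y; apply: inj; rewrite linearP /= !gK.
by exists (@comb t) => // c; apply: inj; rewrite gK.
Qed.

End FinSpan.

Section FreeNil.
Variables (k : fieldType) (n p : nat).

Definition freeNil := lieQuot (LieIdeal (lcs_ideal (freeLie k n) p.+1)).
HB.instance Definition _ := Lie.on freeNil.

Definition freeNil_proj : freeLie k n -> freeNil := @to_quot _ _ _.
Fact freeNil_proj_linear : linear freeNil_proj.
Proof. exact: to_quot_linear. Qed.
HB.instance Definition _ := GRing.isLinear.Build k (freeLie k n) freeNil _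
  freeNil_proj freeNil_proj_linear.

Lemma freeNil_proj_lie : lie_morph freeNil_proj.
Proof. exact: to_quot_lie. Qed.

Lemma freeNil_projP u : exists x, u = freeNil_proj x.
Proof. exact: to_quotP. Qed.

Lemma freeNil_proj_eq0 x : freeNil_proj x = 0 <-> lcs (freeLie k n) p.+1 x.
Proof. exact: to_quot_eq0. Qed.

Local Notation L := (freeLie k n).

(* Left-normed brackets of [i.+1] generators *)
Fixpoint left_normed i : seq L :=
  if i is j.+1 then
    [seq [< free_gen k i, x >] | i <- enum 'I_n, x <- left_normed j]
  else [seq free_gen k i | i <- enum 'I_n].

Let mem_gen i : free_gen k i \in left_normed 0.
Proof. by apply: map_f; rewrite mem_enum. Qed.

Let split1 x : exists2 y, lspan (left_normed 0) y & lcs L 2 (x - y).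
Proof.
have [S0 SL] := submod_lspan (left_normed 0).
have [T0 TL] := submod_lcs L 2.
elim/freeLie_ind: x => [i||x y _ _].
- by exists (free_gen k i); [exact: mem_lspan | rewrite subrr].
- split=> [|a x y [x' Sx Tx] [y' Sy Ty]]; first by exists 0; rewrite ?subrr.
  exists (a *: x' + y'); first exact: SL.
  by rewrite opprD addrACA -scalerBr; exact: TL.
- by exists 0 => //; rewrite subr0; exact: lcs_lie.
Qed.

Let splitS i x : lcs L i.+1 x ->
  exists2 y, lspan (left_normed i) y & lcs L i.+2 (x - y).
Proof.
elim: i x => [|i IH] x; first by move=> _; exact: split1.
have [S0 SL] := submod_lspan (left_normed i.+1).
have [T0 TL] := submod_lcs L i.+3.
rewrite lcsS; move: x; apply: smallest_sub.
  split=> [|a x y [x' Sx Tx] [y' Sy Ty]]; first by exists 0; rewrite ?subrr.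
  exists (a *: x' + y'); first exact: SL.
  by rewrite opprD addrACA -scalerBr; exact: TL.
move=> _ [x _ [y Ly <-]].
have [x' Sx Tx] := split1 x; have [y' Sy Ty] := IH _ Ly.
exists [< x', y' >].
  move: x' Sx {Tx}; apply: lspan_sub.
    split=> [|a u v]; rewrite /= ?lie0r // => Su Sv.
    by rewrite lie_linearl; apply: SL.
  move=> _ /mapP[j _ ->]; move: y' Sy {Ty}; apply: lspan_sub.
    split=> [|a u v]; rewrite /= ?lier0 // => Su Sv.
    by rewrite lie_linearr; apply: SL.
  move=> y' Sy'; apply: mem_lspan.
  by apply: (allpairs_f (fun i x => [< free_gen k i, x >])); rewrite ?mem_enum.
have -> : [< x, y >] - [< x', y' >] = [< x - x', y >] + [< x', y - y' >].
  by rewrite lieDl lieNl lieDr lieNr addrA subrK.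
by apply: (submodD (submod_lcs L i.+3)); [exact: lcs2_lie|exact: lcs_lie].
Qed.

Let freeNil_span : exists s : seq freeNil, lspan s = setT.
Proof.
pose s := flatten [seq left_normed i | i <- iota 0 p].
have spans x : exists2 y, lspan s y & lcs L p.+1 (x - y).
  rewrite /s; elim: p x => [|q IH] x.
    by exists 0; [case: (submod_lspan (Nil L))|].
  have [y Sy Ty] := IH x; have [z Sz Tz] := splitS Ty.
  exists (y + z); last by rewrite opprD addrA.
  rewrite -addn1 iotaD map_cat flatten_cat /= cats0.
  apply: (submodD (submod_lspan _)).
  - move: y Sy {Ty Tz}; apply: lspan_sub; first exact: submod_lspan.
    by move=> y ys; apply: mem_lspan; rewrite mem_cat ys.
  - move: z Sz {Tz}; apply: lspan_sub; first exact: submod_lspan.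
    by move=> z zs; apply: mem_lspan; rewrite mem_cat zs orbT.
exists (map freeNil_proj s); apply/seteqP; split=> // u _.
have [x ->] := freeNil_projP u; have [y Sy Ty] := spans x.
have -> : freeNil_proj x = freeNil_proj y by apply/(to_quotE (LieIdeal _)).
move: y Sy {Ty}; apply: lspan_sub.
  have [T0 TL] := submod_lspan (map freeNil_proj s).
  split=> [|a v w]; first by rewrite /= linear0.
  by move=> /= Tv Tw; rewrite linearP; apply: TL.
by move=> y ys; apply: mem_lspan; exact: map_f.
Qed.

Let freeNil_dim : exists d, inhabited (Vector.axiom d freeNil).
Proof. by have [s /fin_span_vector] := freeNil_span. Qed.

Let freeNil_vector : Vector.axiom (projT1 (cid freeNil_dim)) freeNil.
Proof. by case: (cid _) => d /= /inhabited_witness. Qed.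

HB.instance Definition _ :=
  Lmodule_hasFinDim.Build k freeNil freeNil_vector.

End FreeNil.

Section Span.
Variables (k : fieldType) (V : vectType k).

Fact vspan_subproof (A : set V) :
  exists U : {vspace V}, forall x, x \in U <-> smallest (@submod k V) A x.
Proof.
pose B := smallest (@submod k V) A.
have sB : submod B := submod_smallest A.
pose P d := `[< exists2 U : {vspace V},
  \dim U = d & forall x, x \in U -> B x >].
have exP : exists d, P d.
  exists 0%N; apply/asboolP; exists 0%VS; first exact: dimv0.
  by move=> x; rewrite memv0 => /eqP ->; case: sB.
have boundP d : P d -> (d <= \dim {:V})%N.
  by move=> /asboolP[U <- _]; exact/dimvS/subvf.
case: (ex_maxnP exP boundP) => d /asboolP[U dU UB] maxd.
exists U => x; split=> [/UB//|Bx].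
pose W := (U + <[x]>)%VS.
have WB y : y \in W -> B y.
  case/memv_addP=> u uU [v /vlineP[a ->] ->].
  by apply: (submodD sB); [exact: UB|exact: (submodZ _ sB)].
have /maxd leW : P (\dim W) by apply/asboolP; exists W.
have /eqP -> : U == W.
  by rewrite eqEdim addvSl dU leW.
by rewrite memvE addvSr.
Qed.

Definition vspan (A : set V) : {vspace V} := sval (cid (vspan_subproof A)).

Lemma mem_vspan (A : set V) x : x \in vspan A <-> smallest (@submod k V) A x.
Proof. by rewrite /vspan; case: cid. Qed.

Lemma mem_vspan_submod (A : set V) x : submod A -> x \in vspan A <-> A x.
Proof. by move=> sA; rewrite mem_vspan smallest_id. Qed.

(* The dimension of [U / (U :&: W)], to which the complement [U :\: W] is
   isomorphic. *)
Definition dim_quot (U W : {vspace V}) : nat := \dim (U :\: W).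

End Span.

Section Cohomology.
Variables (k : fieldType) (g : finLieType k).

(* The degree 2 part of the Chevalley-Eilenberg complex with trivial
   coefficients. A 2-cochain is an alternating bilinear form, curried here;
   alternating means [w x x = 0], also in characteristic 2. *)
Definition bilform := 'Hom(g, 'Hom(g, k^o)).

Definition cocycle2 : set bilform := [set w : bilform |
  (forall x, w x x = 0) /\
  forall x y z, w [< x, y >] z - w [< x, z >] y + w [< y, z >] x = 0].

Definition coboundary2 : set bilform := [set w : bilform |
  exists f : 'Hom(g, k^o), forall x y, w x y = - f [< x, y >]].

Lemma submod_cocycle2 : submod cocycle2.
Proof.
split=> [|a v w [v0 vZ] [w0 wZ]].
  by split=> *; rewrite !zero_lfunE ?subr0 ?addr0.
split=> [x|x y z]; rewrite !(add_lfunE, scale_lfunE).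
  by rewrite v0 w0 scaler0 addr0.
rewrite opprD [X in X + _]addrACA -scalerBr addrACA -scalerDr vZ scaler0 add0r.
exact: wZ.
Qed.

Lemma submod_coboundary2 : submod coboundary2.
Proof.
split=> [|a v w [f fE] [h hE]].
  by exists 0 => x y; rewrite !zero_lfunE oppr0.
exists (a *: f + h) => x y.
by rewrite !(add_lfunE, scale_lfunE) fE hE opprD scalerN.
Qed.

Lemma coboundary2_cocycle2 : coboundary2 `<=` cocycle2.
Proof.
move=> w [f fE]; split=> [x|x y z]; first by rewrite fE liexx linear0 oppr0.
rewrite !fE.
have -> : [< [< x, y >], z >] = - [< z, [< x, y >] >] by rewrite lieC.
have -> : [< [< x, z >], y >] = [< y, [< z, x >] >].
  by rewrite lieC (lieC x z) lieNr opprK.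
have -> : [< [< y, z >], x >] = - [< x, [< y, z >] >] by rewrite lieC.
rewrite !linearN !opprK -!linearD -(linear0 f) -(lie_jacobi x y z).
by congr (f _); rewrite -addrA addrC; congr (_ + _); exact: addrC.
Qed.

Definition b2 : nat := dim_quot (vspan cocycle2) (vspan coboundary2).

End Cohomology.

Section Extensions.
Variable k : fieldType.

(* [0 -> M -> E -> G -> 0], where [M] is a subspace of [E] *)
Definition short_exact (E G : finLieType k) (M : {vspace E})
    (rho : 'Hom(E, G)) :=
  [/\ lie_morph rho, lker rho = M & limg rho = fullv].

Definition has_central_extension (G : finLieType k) (c : nat) :=
  exists (E : finLieType k) (M : {vspace E}) (rho : 'Hom(E, G)),
    [/\ short_exact M rho, [set` M] `<=` lie_center E & nilpotent_class E c].

Definition lie_vprod (E : finLieType k) (U W : {vspace E}) : {vspace E} :=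
  vspan (lie_prod [set` U] [set` W]).

Definition free_nil_extension (G : finLieType k) (n p : nat)
    (N : {vspace freeNil k n p}) (pi : 'Hom(freeNil k n p, G)) :=
  [/\ n = dim_quot fullv (lie_vprod fullv fullv : {vspace G}),
      short_exact N pi & (N <= lie_vprod fullv fullv)%VS].

End Extensions.

(* Main.v *)
From HB Require Import structures.
Require Import Defs.
From mathcomp Require Import all_boot all_order all_algebra.
From mathcomp Require Import boolp classical_sets.
From mathcomp Require Import zify ring.

(** Let [L] be the free Lie algebra on [n] generators, [F] and [K] its largest
    quotients of class [p] and [p.+1], [q : K -> F] the truncation, and [R] the
    kernel of [pi \o q : K -> g], so that [q] maps [R] onto [N] and
    [[K, R]] onto [[F, N]]. Everything is read off from the single inclusion
    [lcs K p.+1 <= [K, R]].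

    The algebra [K / [K, R]] is the largest central extension of [g] generated
    by [n] elements and nilpotent of class at most [p.+1]. Any central extension
    of class [p.+1] receives a morphism from [K], which kills [[K, R]] and is
    onto up to central elements, hence onto on the last term of the lower
    central series. So [g] has such an extension exactly when [lcs K p.+1] is
    not contained in [[K, R]] (central_extension_criterion).

    Hopf's formula gives [b2 g = dim R / [K, R]] (hopf_formula). It is proved
    dually: a linear form on [K] that kills [[K, R]] sends a bracket [[u, v]] to
    a number that depends on the images of [u] and [v] in [g] only, which is a
    2-cocycle of [g]. The forms that vanish on [R] give the coboundaries, and
    every cocycle arises since [K] maps to the extension of [g] by the line that
    the cocycle defines. The kernel of [q] is [lcs K p.+1] and lies in [R], so
    passing from [R / [K, R]] to [N / [F, N]] loses dimension exactly when that
    kernel is not inside [[K, R]]; this is the first assertion.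

    If a single [X] generates [N] and the inclusion held, then [lcs L p.+1]
    would be contained in [J + lcs L p.+2], where [J] is the ideal of [L]
    generated by a lift of [X]. This is refuted in a metabelian Lie algebra
    (metab) where the brackets are polynomials, on which two generators act by
    multiplication by two algebraically independent elements: the image of [J]
    there consists of multiples of one polynomial [f], and if [f] has no
    constant term then its multiples cannot account, to lowest order, for both
    [p.-1]-th powers of these elements (monomials_not_multiples). The constant
    term of [f] is a value of an alternating form attached to [X]; for [n >= 3]
    two independent weights can be chosen for which this value is zero
    (rank3_isotropic). For [n = 2] a nonzero constant term means that [X] spans
    the second term of the lower central series modulo the third, so that [g] is
    abelian, and then [X = 0]. Finally [n <= 1] would force [dim g <= 1]
    (rank_gt1). *)

Set Implicit Arguments.
Unset Strict Implicit.
Unset Printing Implicit Defensive.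

Import GRing.Theory.
Local Open Scope ring_scope.
Local Open Scope classical_set_scope.

(** * Morphisms and the lower central series *)

Section Submodules.
Variables (k : fieldType).

Lemma submod_preimage (V W : lmodType k) (f : {linear V -> W}) (A : set W) :
  submod A -> submod (f @^-1` A).
Proof.
by case=> A0 AL; split=> [|a x y Ax Ay]; rewrite /= ?linear0 ?linearP //;
  exact: AL.
Qed.

Lemma submod_image (V W : lmodType k) (f : {linear V -> W}) (A : set V) :
  submod A -> submod (f @` A).
Proof.
case=> A0 AL; split=> [|a _ _ [x Ax <-] [y Ay <-]].
  by exists 0; rewrite ?linear0.
by exists (a *: x + y); rewrite ?linearP //; exact: AL.
Qed.

Lemma submod_vspace (V : vectType k) (U : {vspace V}) : submod [set` U].
Proof.
split=> [|a x y Ux Uy]; rewrite /=; first exact: mem0v.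
by rewrite memvD ?memvZ.
Qed.

End Submodules.

Section LieMorphisms.
Variables (k : fieldType).

Lemma submod_lie_center (L : lieType k) : submod (lie_center L).
Proof.
split=> [y|a x y cx cy z]; first exact: lie0r.
by rewrite lie_linearl cx cy scaler0 addr0.
Qed.

Lemma lie_center_sym (L : lieType k) (x y : L) :
  lie_center L y -> [< x, y >] = 0.
Proof. by move=> cy; rewrite lieC cy oppr0. Qed.

Lemma lie_prodM (L : lieType k) (A B : set L) x y :
  A x -> B y -> lie_prod A B [< x, y >].
Proof. by move=> Ax By; apply: sub_gen_smallest; exists x => //; exists y. Qed.

Lemma lie_prod_sub (L : lieType k) (A B C : set L) : submod C ->
  (forall x y, A x -> B y -> C [< x, y >]) -> lie_prod A B `<=` C.
Proof.
by move=> sC ABC; apply: smallest_sub => // _ [x Ax [y By <-]]; exact: ABC.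
Qed.

Lemma lcs0P (L : lieType k) i :
  lcs L i = [set 0] <-> forall x, lcs L i x -> x = 0.
Proof.
split=> [-> //|e]; apply/seteqP; split=> [x /e //|_ ->].
by case: (submod_lcs L i).
Qed.

Lemma lcs_le (L : lieType k) i j : (i <= j)%N -> lcs L j.+1 `<=` lcs L i.+1.
Proof.
move=> /subnK <-; elim: (j - i)%N => [//|d IH] x Lx.
by apply: IH; exact: lcs_desc.
Qed.

Variables (L1 L2 : lieType k) (f : {linear L1 -> L2}).
Hypothesis f_lie : lie_morph f.

Lemma lcs_morph i x : lcs L1 i x -> lcs L2 i (f x).
Proof.
case: i => [|i] //; elim: i x => [//|i IH] x; rewrite lcsS; move: x.
apply: lie_prod_sub; first exact: (submod_preimage f (submod_lcs L2 i.+2)).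
by move=> x y _ Ly; rewrite /= f_lie; apply: lcs_lie; exact: IH.
Qed.

(** Brackets do not see central summands, so a morphism that is onto modulo
    the centre is onto each deeper term of the lower central series. *)
Lemma lcs_lift i y : (forall y, exists x, lie_center L2 (y - f x)) ->
  lcs L2 i.+2 y -> exists2 x, lcs L1 i.+2 x & f x = y.
Proof.
move=> f_onto.
have step j : (forall y, lcs L2 j.+1 y ->
      exists2 x, lcs L1 j.+1 x & lie_center L2 (y - f x)) ->
    lcs L2 j.+2 `<=` f @` lcs L1 j.+2.
  move=> onto_j; apply: lie_prod_sub.
    by exact: (submod_image f (submod_lcs L1 j.+2)).
  move=> u v _ /onto_j[v' Lv' cv]; have [u' cu] := f_onto u.
  exists [< u', v' >]; first exact: lcs_lie.
  rewrite f_lie; apply/eqP; rewrite -subr_eq0; apply/eqP.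
  have -> : [< f u', f v' >] - [< u, v >] =
            - ([< u - f u', f v' >] + [< u, v - f v' >]).
    by rewrite lieDl lieDr lieNl lieNr [X in _ = - X]addrC addrA subrK opprB.
  by rewrite cu (lie_center_sym u cv) addr0 oppr0.
suff onto_j j : lcs L2 j.+2 `<=` f @` lcs L1 j.+2.
  by move=> /onto_j[x Lx <-]; exists x.
elim: j => [|j IH]; apply: step => u.
  by have [x cx] := f_onto u; exists x.
move=> /IH[x Lx <-]; exists x => //; rewrite subrr.
by case: (submod_lie_center L2).
Qed.

Lemma lcs_onto i y : (forall y, exists x, f x = y) ->
  lcs L2 i y -> exists2 x, lcs L1 i x & f x = y.
Proof.
move=> f_onto; case: i => [|[|i]]; [|by have [x <-] := f_onto y; exists x..|].
  by have [x <-] := f_onto y; exists x.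
apply: lcs_lift => u; have [x <-] := f_onto u; exists x.
by rewrite subrr; case: (submod_lie_center L2).
Qed.

(** A central extension raises the nilpotency class by at most one. *)
Lemma lcs_central m : (forall x, f x = 0 -> lie_center L1 x) ->
  lcs L2 m.+1 = [set 0] -> lcs L1 m.+2 = [set 0].
Proof.
move=> kerf L2m; apply/lcs0P => x; rewrite lcsS; move: x.
apply: lie_prod_sub.
  by split=> [//|a x y /= -> ->]; rewrite scaler0 addr0.
move=> x y _ /lcs_morph; rewrite L2m => /kerf cy.
exact: lie_center_sym.
Qed.

End LieMorphisms.

Section Ideals.
Variables (k : fieldType) (L1 L2 : lieType k) (f : {linear L1 -> L2}).
Hypothesis f_lie : lie_morph f.

Lemma lie_ideal_preimage (A : set L2) : lie_ideal A -> lie_ideal (f @^-1` A).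
Proof.
case=> sA idA; split; first exact: (submod_preimage f sA).
by move=> x y Ay; rewrite /= f_lie; exact: idA.
Qed.

Lemma lie_ideal_image (A : set L1) : (forall y, exists x, f x = y) ->
  lie_ideal A -> lie_ideal (f @` A).
Proof.
move=> f_onto [sA idA]; split; first exact: (submod_image f sA).
move=> y _ [x Ax <-]; have [z <-] := f_onto y.
by exists [< z, x >]; rewrite ?f_lie //; exact: idA.
Qed.

End Ideals.

Lemma lie_ideal_gen (k : fieldType) (L : lieType k) (A : set L) :
  lie_ideal (ideal_gen A).
Proof.
split; first split.
- by move=> B [[[B0 _] _] _].
- move=> a x y Ax Ay B [idB AB]; case: (idB) => [[_ BL] _].
  by apply: BL; [apply: Ax | apply: Ay].
- by move=> x y Ay B [idB AB]; case: (idB) => [_]; apply; apply: Ay.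
Qed.

(** * Finite-dimensional Lie algebras and their quotients *)

Section FiniteDimensional.
Variable k : fieldType.

Lemma mem_lie_vprod (E : finLieType k) (U W : {vspace E}) x :
  x \in lie_vprod U W <-> lie_prod [set` U] [set` W] x.
Proof. by rewrite /lie_vprod mem_vspan_submod //; exact: submod_smallest. Qed.

Lemma mem_lie_vprodM (E : finLieType k) (U W : {vspace E}) x y :
  x \in U -> y \in W -> [< x, y >] \in lie_vprod U W.
Proof. by move=> Ux Wy; apply/mem_lie_vprod; exact: lie_prodM. Qed.

Lemma lie_vprod_sub (E : finLieType k) (U W C : {vspace E}) :
  (forall x y, x \in U -> y \in W -> [< x, y >] \in C) ->
  (lie_vprod U W <= C)%VS.
Proof.
move=> UWC; apply/subvP => x /mem_lie_vprod; move: x.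
by apply: lie_prod_sub; [exact: submod_vspace|exact: UWC].
Qed.

Lemma mem_lcs2 (E : finLieType k) (x : E) :
  x \in lie_vprod fullv fullv <-> lcs E 2 x.
Proof.
rewrite mem_lie_vprod lcsS; suff -> : [set` fullv] = [set: E] by [].
by apply/seteqP; split=> // y _; rewrite /= memvf.
Qed.

Lemma lie_vprod_img (E G : finLieType k) (f : 'Hom(E, G)) (U W : {vspace E}) :
  lie_morph f -> (f @: lie_vprod U W = lie_vprod (f @: U) (f @: W))%VS.
Proof.
move=> f_lie; apply: subv_anti; apply/andP; split.
  apply/subvP => _ /memv_imgP[x Ux ->].
  suff /subvP/(_ x Ux) :
      (lie_vprod U W <= f @^-1: lie_vprod (f @: U) (f @: W))%VS.
    by rewrite -memv_preim.
  apply: lie_vprod_sub => u w Uu Ww; rewrite -memv_preim f_lie.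
  by apply: mem_lie_vprodM; apply: memv_img.
apply: lie_vprod_sub => _ _ /memv_imgP[u Uu ->] /memv_imgP[w Ww ->].
by rewrite -f_lie memv_img // mem_lie_vprodM.
Qed.

Lemma dim_quotS (V : vectType k) (U W : {vspace V}) :
  (W <= U)%VS -> (dim_quot U W + \dim W = \dim U)%N.
Proof.
move=> WU; have := dimv_cap_compl U W.
by rewrite /dim_quot (capv_idPr WU) addnC.
Qed.

End FiniteDimensional.

(** Turns maps that are defined through representatives of classes, and have no
    canonical structure, into elements of ['Hom]. *)
Lemma linear_lfun (k : fieldType) (V W : vectType k) (f : V -> W) :
  linear f -> exists h : 'Hom(V, W), h =1 f.
Proof.
move=> f_linear; pose fL := GRing.isLinear.Build _ _ _ _ f f_linear.
pose f' : {linear V -> W} := HB.pack f fL.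
by exists (linfun f') => x; rewrite lfunE.
Qed.

Section FiniteQuotient.
Variables (k : fieldType) (E : finLieType k) (I : lieIdeal E).

(** [lieQuot] carries no dimension; the image of a basis spans it, which is
    enough to make it a [finLieType]. *)
Definition finQuot := lieQuot I.
HB.instance Definition _ := Lie.on finQuot.

Let finQuot_dim : exists d, inhabited (Vector.axiom d finQuot).
Proof.
pose s : seq finQuot := map (@to_quot _ _ I) (vbasis {:E}).
have ss := submod_lspan s; apply: (@fin_span_vector k finQuot s).
apply/seteqP; split=> // u _; have [x ->] := to_quotP u.
have := memvf x; rewrite -(span_basis (vbasisP fullv)) => /coord_span ->.
rewrite linear_sum; apply: (big_ind (lspan s)) => [|y z|i _]; first by case: ss.
  exact: (submodD ss).
rewrite linearZ; apply: (submodZ _ ss); apply: mem_lspan.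
by apply: map_f; rewrite mem_nth // size_tuple.
Qed.

Let finQuot_vector : Vector.axiom (projT1 (cid finQuot_dim)) finQuot.
Proof. by case: (cid _) => d /= /inhabited_witness. Qed.

HB.instance Definition _ :=
  Lmodule_hasFinDim.Build k finQuot finQuot_vector.

Definition finQuot_proj : E -> finQuot := @to_quot _ _ I.
Fact finQuot_proj_linear : linear finQuot_proj.
Proof. exact: to_quot_linear. Qed.
HB.instance Definition _ := GRing.isLinear.Build k E finQuot _
  finQuot_proj finQuot_proj_linear.

Definition quot_map : 'Hom(E, finQuot) := linfun finQuot_proj.

Lemma quot_mapE x : quot_map x = to_quot I x.
Proof. by rewrite lfunE. Qed.

Lemma quot_map_lie : lie_morph quot_map.
Proof. by move=> x y; rewrite !quot_mapE; exact: to_quot_lie. Qed.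

Lemma quot_map_onto u : exists x, quot_map x = u.
Proof. by have [x ->] := to_quotP u; exists x; rewrite quot_mapE. Qed.

Lemma quot_map_eq0 x : quot_map x = 0 <-> ideal_set I x.
Proof. by rewrite quot_mapE to_quot_eq0. Qed.

End FiniteQuotient.

(** * Universal properties of free nilpotent Lie algebras *)

Section FreeNilpotent.
Variables (k : fieldType) (n : nat).

Lemma freeLie_ext (L : lieType k) (f h : {linear freeLie k n -> L}) :
  lie_morph f -> lie_morph h ->
  (forall i, f (free_gen k i) = h (free_gen k i)) -> f =1 h.
Proof.
move=> f_lie h_lie fh x; rewrite (free_lift_uniq h_lie (fun=> erefl)).
exact: free_lift_uniq.
Qed.

Lemma freeNil_proj_onto p (u : freeNil k n p) : exists x, freeNil_proj p x = u.
Proof. by have [x ->] := freeNil_projP u; exists x. Qed.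

Lemma lcs_freeNil p i (u : freeNil k n p) : lcs (freeNil k n p) i u ->
  exists2 x, lcs (freeLie k n) i x & freeNil_proj p x = u.
Proof.
exact: (lcs_onto (@freeNil_proj_lie k n p) (@freeNil_proj_onto p)).
Qed.

Lemma freeNil_nilpotent p : lcs (freeNil k n p) p.+1 = [set 0].
Proof. by apply/lcs0P => u /lcs_freeNil[x Lx <-]; apply/freeNil_proj_eq0. Qed.

(** A morphism into an algebra of class at most [p] kills [lcs _ p.+1], so its
    value does not depend on the chosen representative. *)
Lemma freeNil_factor p (E : finLieType k) (f : {linear freeLie k n -> E}) :
    lie_morph f -> lcs E p.+1 = [set 0] ->
  exists2 h : 'Hom(freeNil k n p, E),
    lie_morph h & forall x, h (freeNil_proj p x) = f x.
Proof.
move=> f_lie E0; pose h (u : freeNil k n p) : E := f (repr u).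
have hE x : h (freeNil_proj p x) = f x.
  apply/eqP; rewrite -subr_eq0 -linearB; apply/eqP.
  have := repr_quotI (LieIdeal (lcs_ideal (freeLie k n) p.+1)) x.
  by move=> /(lcs_morph f_lie); rewrite E0.
have h_linear : linear h.
  move=> a u v; have [x ->] := freeNil_projP u; have [y ->] := freeNil_projP v.
  by rewrite -linearP !hE linearP.
have [h' h'E] := linear_lfun h_linear.
exists h' => [u v|x]; last by rewrite h'E.
rewrite !h'E.
have [x ->] := freeNil_projP u; have [y ->] := freeNil_projP v.
by rewrite -freeNil_proj_lie !hE f_lie.
Qed.

(** The nilpotent form of freeness: lifting along a surjection whose source is
    nilpotent of small enough class. *)
Lemma freeNil_lift p (E G : finLieType k) (rho : 'Hom(E, G))
    (f : 'Hom(freeNil k n p, G)) :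
    lie_morph rho -> lie_morph f -> limg rho = fullv ->
    lcs E p.+1 = [set 0] ->
  exists2 h : 'Hom(freeNil k n p, E), lie_morph h & forall u, rho (h u) = f u.
Proof.
move=> rho_lie f_lie rho_onto E0.
have lift y : exists x, rho x = y.
  by have := memvf y; rewrite -rho_onto => /memv_imgP[x _ ->]; exists x.
have [s sE] := choice lift.
pose f' := free_lift (fun i => s (f (freeNil_proj p (free_gen k i)))).
have [h h_lie hE] := freeNil_factor (@free_lift_lie _ _ _ _ : lie_morph f') E0.
exists h => // u; have [x ->] := freeNil_projP u; rewrite hE.
move: x; apply: (freeLie_ext (f := rho \o f') (h := f \o freeNil_proj p)).
- by move=> x y; rewrite /= free_lift_lie rho_lie.
- by move=> x y; rewrite /= freeNil_proj_lie f_lie.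
- by move=> i; rewrite /= /f' free_lift_gen sE.
Qed.

End FreeNilpotent.

(** * The extension of a Lie algebra by a 2-cocycle *)

(** The argument [w] occurs only in the bracket: it indexes the type so that
    each cocycle has its own Lie structure on [g * k^o]. *)
Definition cocycle_ext (k : fieldType) (g : finLieType k)
  (w : {w : bilform g | cocycle2 w}) : Type := (g * k^o)%type.

Section CocycleExtension.
Variables (k : fieldType) (g : finLieType k) (w : {w : bilform g | cocycle2 w}).

Let w_alt x : sval w x x = 0. Proof. by case: (svalP w). Qed.

Let w_anti x y : sval w x y = - sval w y x.
Proof.
apply/eqP; rewrite -addr_eq0; have := w_alt (x + y).
by rewrite !linearD /= !add_lfunE !w_alt add0r addr0 addrC => ->.
Qed.

Local Notation ext := (cocycle_ext w).
HB.instance Definition _ := Vector.copy ext (g * k^o)%type.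

Let elie (x y : ext) : ext :=
  ([< x.1, y.1 >], sval w x.1 y.1).

Let elie_linearl a x y z : elie (a *: x + y) z = a *: elie x z + elie y z.
Proof.
by rewrite /elie /= lie_linearl linearP add_lfunE scale_lfunE.
Qed.

Let elie_linearr a x y z : elie z (a *: x + y) = a *: elie z x + elie z y.
Proof. by rewrite /elie /= lie_linearr linearP. Qed.

Let eliexx x : elie x x = 0.
Proof. by rewrite /elie liexx w_alt. Qed.

Let elie_jacobi x y z :
  elie x (elie y z) + elie y (elie z x) + elie z (elie x y) = 0.
Proof.
congr (_, _); first exact: lie_jacobi.
have [_ /(_ x.1 y.1 z.1) wz] := svalP w.
have wzx : sval w y.1 [< z.1, x.1 >] = sval w [< x.1, z.1 >] y.1.
  by rewrite w_anti lieC linearN opp_lfunE opprK.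
rewrite /= wzx (w_anti x.1) (w_anti z.1).
by rewrite -[RHS]oppr0 -wz !opprD opprK [RHS]addrC [X in _ = _ + X]addrC addrA.
Qed.

HB.instance Definition _ := isLie.Build k ext
  elie_linearl elie_linearr eliexx elie_jacobi.

Lemma cocycle_extE (x y : ext) :
  [< x, y >] = ([< x.1, y.1 >], sval w x.1 y.1) :> ext.
Proof. by []. Qed.

Lemma cocycle_ext_central (x : ext) : x.1 = 0 -> lie_center ext x.
Proof.
by move=> x1 y; rewrite cocycle_extE x1 lie0r linear0 zero_lfunE.
Qed.

End CocycleExtension.

(** * Hopf's formula for the second Betti number *)

Section Annihilator.
Variables (k : fieldType) (V : vectType k).
Implicit Types (U W : {vspace V}) (psi : 'Hom(V, k^o)).

(** Restriction to [U] is onto, so its kernel, the annihilator of [U], has the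
    codimension of [U]. *)
Definition restrict U psi : 'Hom(subvs_of U, k^o) := (psi \o linfun vsval)%VF.

Fact restrict_linear U : linear (restrict U).
Proof. by move=> a psi chi; rewrite /restrict comp_lfunDl comp_lfunZl. Qed.

HB.instance Definition _ U :=
  GRing.isLinear.Build k _ _ _ (restrict U) (@restrict_linear U).

Definition annihilator U : {vspace 'Hom(V, k^o)} := lker (linfun (restrict U)).

Lemma annihilatorP U psi :
  reflect (forall x, x \in U -> psi x = 0) (psi \in annihilator U).
Proof.
apply: (iffP idP); rewrite memv_ker lfunE /=.
  move=> /eqP/lfunP psi0 x Ux; have := psi0 (vsproj U x).
  by rewrite comp_lfunE lfunE /= vsprojK // zero_lfunE.
move=> psi0; apply/eqP/lfunP => x.
by rewrite comp_lfunE lfunE /= psi0 ?subvsP // zero_lfunE.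
Qed.

Lemma annihilatorS U W : (U <= W)%VS -> (annihilator W <= annihilator U)%VS.
Proof.
move=> /subvP UW; apply/subvP => psi /annihilatorP psiW.
by apply/annihilatorP => x /UW; exact: psiW.
Qed.

Lemma dim_annihilator U : (\dim (annihilator U) + \dim U = \dim {:V})%N.
Proof.
have onto : limg (linfun (restrict U)) = fullv.
  apply/eqP; rewrite eqEsubv subvf; apply/subvP => phi _.
  apply/memv_imgP; exists (phi \o linfun (vsproj U))%VF; rewrite ?memvf //.
  apply/lfunP => x.
  by rewrite lfunE /= /restrict !comp_lfunE !lfunE /= vsvalK.
have := limg_ker_dim (linfun (restrict U)) fullv.
rewrite capfv onto !dimvf.
have dim_dual (W : vectType k) : dim 'Hom(W, k^o) = dim W by exact: muln1.
by rewrite !dim_dual.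
Qed.

End Annihilator.

Section Hopf.
Variables (k : fieldType) (K g : finLieType k) (pi : 'Hom(K, g)).
Hypotheses (pi_lie : lie_morph pi) (pi_onto : limg pi = fullv).

Lemma onto_lfun x : exists u, pi u = x.
Proof.
by have := memvf x; rewrite -pi_onto => /memv_imgP[u _ ->]; exists u.
Qed.

(** A linear section of [pi]; it need not respect brackets. *)
Definition section_lfun : 'Hom(g, K) := (pi^-1)%VF.
Local Notation s := section_lfun.

Let sK x : pi (s x) = x.
Proof. by apply: limg_lfunVK; rewrite pi_onto memvf. Qed.

Definition pull_value (psi : 'Hom(K, k^o)) (x y : g) : k^o :=
  psi [< s x, s y >].

Fact pull_value_linear psi x : linear (pull_value psi x).
Proof. by move=> a y z; rewrite /pull_value linearP lie_linearr linearP. Qed.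
HB.instance Definition _ psi x :=
  GRing.isLinear.Build k _ _ _ (pull_value psi x) (@pull_value_linear psi x).

Definition pull_row psi (x : g) : 'Hom(g, k^o) := linfun (pull_value psi x).

Fact pull_row_linear psi : linear (pull_row psi).
Proof.
move=> a x y; apply/lfunP => z; rewrite add_lfunE scale_lfunE !lfunE /=.
by rewrite /pull_value linearP lie_linearl linearP.
Qed.
HB.instance Definition _ psi :=
  GRing.isLinear.Build k _ _ _ (pull_row psi) (@pull_row_linear psi).

Definition pull_form psi : bilform g := linfun (pull_row psi).

Lemma pull_formE psi x y : pull_form psi x y = psi [< s x, s y >].
Proof. by rewrite /pull_form lfunE /= lfunE. Qed.

Fact pull_form_linear : linear pull_form.
Proof.
move=> a psi phi; apply/lfunP => x; apply/lfunP => y.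
by rewrite !(add_lfunE, scale_lfunE) !pull_formE add_lfunE scale_lfunE.
Qed.
HB.instance Definition _ :=
  GRing.isLinear.Build k _ _ _ pull_form pull_form_linear.

(** Composing a linear form with brackets of lifts gives a bilinear form on [g].
    On the annihilator of [KR] the choice of lifts is immaterial and the result
    is a cocycle; up to sign its class is the transgression, in the five-term
    exact sequence, of the restriction of the form to [R]. *)
Definition transgression : 'Hom('Hom(K, k^o), bilform g) := linfun pull_form.

Local Notation R := (lker pi).
Local Notation KR := (lie_vprod fullv R).

Let lker_diff u v : pi u = pi v -> u - v \in R.
Proof. by move=> uv; rewrite memv_ker linearB /= uv subrr. Qed.

Lemma lie_vprod_lker : (KR <= R)%VS.
Proof.
apply: lie_vprod_sub => x y _; rewrite !memv_ker pi_lie => /eqP ->.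
by rewrite lier0.
Qed.

(** Two lifts differ by an element of [R], so their brackets differ by an
    element of [KR]. *)
Lemma transgressionE psi u v : psi \in annihilator KR ->
  transgression psi (pi u) (pi v) = psi [< u, v >].
Proof.
move=> /annihilatorP psi0; rewrite /transgression lfunE pull_formE.
apply/eqP; rewrite -subr_eq0 -linearB /= psi0 //.
have -> : [< s (pi u), s (pi v) >] - [< u, v >] =
    [< s (pi u), s (pi v) - v >] - [< v, s (pi u) - u >].
  by rewrite !lieDr !lieNr (lieC v _) (lieC v u) opprD !opprK addrA subrK.
by apply: memvB; apply: mem_lie_vprodM; rewrite ?memvf //; apply: lker_diff.
Qed.

Lemma transgression_eq0 psi : psi \in annihilator KR ->
  transgression psi = 0 <-> psi \in annihilator (lie_vprod fullv fullv).
Proof.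
move=> psiKR; split=> [psi0|/annihilatorP psi0].
  apply/annihilatorP => x Ux; apply/eqP; rewrite -memv_ker.
  move: x Ux; apply/subvP.
  apply: lie_vprod_sub => u v _ _.
  by rewrite memv_ker -(transgressionE _ _ psiKR) psi0 !zero_lfunE.
apply/lfunP => x; apply/lfunP => y; have [u <-] := onto_lfun x.
have [v <-] := onto_lfun y; rewrite transgressionE // !zero_lfunE.
by rewrite psi0 // mem_lie_vprodM ?memvf.
Qed.

Lemma transgression_cocycle psi : psi \in annihilator KR ->
  cocycle2 (transgression psi).
Proof.
move=> psiKR; split=> [x|x y z].
  by have [u <-] := onto_lfun x; rewrite transgressionE // liexx linear0.
have [u <-] := onto_lfun x; have [v <-] := onto_lfun y.
have [t <-] := onto_lfun z; rewrite -!pi_lie !transgressionE //.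
rewrite -linearB -linearD -(linear0 psi); congr (psi _).
rewrite lie_leibniz (lieC [< u, t >]) (lieC [< v, t >]) opprK.
by rewrite subrK subrr.
Qed.

Hypothesis R_sub : (R <= lie_vprod fullv fullv)%VS.

(** A form that kills [R] factors through [g], where its composite with the
    bracket is a coboundary, up to the sign in the differential. *)
Lemma transgression_coboundary :
  vspan (@coboundary2 k g) = (transgression @: annihilator R)%VS.
Proof.
apply/vspaceP => w; apply/idP/idP.
  move=> /(mem_vspan_submod _ (@submod_coboundary2 k g))[f fE].
  have piR : (- (f \o pi))%VF \in annihilator R.
    apply/annihilatorP => u; rewrite memv_ker => /eqP pu.
    by rewrite opp_lfunE comp_lfunE pu linear0 oppr0.
  have -> : w = transgression (- (f \o pi))%VF; last exact: memv_img.
  apply/lfunP => x; apply/lfunP => y; have [u <-] := onto_lfun x.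
  have [v <-] := onto_lfun y; rewrite transgressionE.
    by rewrite fE opp_lfunE comp_lfunE pi_lie.
  exact: subvP (annihilatorS lie_vprod_lker) _ piR.
move=> /memv_imgP[psi psiR ->].
apply/(mem_vspan_submod _ (@submod_coboundary2 k g)).
exists (- (psi \o s))%VF => x y; rewrite opp_lfunE comp_lfunE opprK.
have [u <-] := onto_lfun x; have [v <-] := onto_lfun y.
rewrite transgressionE; last exact: subvP (annihilatorS lie_vprod_lker) _ psiR.
rewrite -pi_lie; apply/eqP; rewrite -subr_eq0 -linearB; apply/eqP.
by move/annihilatorP: psiR; apply; apply: lker_diff; rewrite sK.
Qed.

Hypothesis pi_lift : forall w : {w : bilform g | cocycle2 w},
  exists2 h : 'Hom(K, cocycle_ext w),
    lie_morph h & forall u, (h u).1 = pi u.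

(** The second component of a lift of [pi] to the extension defined by [w] is a
    linear form on [K] whose composite with the bracket is [w]. *)
Lemma transgression_cocycle2 :
  vspan (@cocycle2 k g) = (transgression @: annihilator KR)%VS.
Proof.
apply/vspaceP => w; apply/idP/idP; last first.
  move=> /memv_imgP[psi psiKR ->].
  apply/(mem_vspan_submod _ (@submod_cocycle2 k g)).
  exact: transgression_cocycle.
move=> /(mem_vspan_submod _ (@submod_cocycle2 k g)) cw.
have [h h_lie h1] := pi_lift (exist _ w cw).
have h2_linear : linear (fun u => (h u).2 : k^o).
  by move=> a u v; rewrite linearP.
have [psi psi2] := linear_lfun h2_linear.
have psiE u v : psi [< u, v >] = w (pi u) (pi v).
  by rewrite psi2 h_lie cocycle_extE /= !h1.
have psiKR : psi \in annihilator KR.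
  apply/annihilatorP => x Ux; apply/eqP; rewrite -memv_ker.
  move: x Ux; apply/subvP.
  apply: lie_vprod_sub => u v _ Rv; rewrite memv_ker psiE.
  by move: Rv; rewrite memv_ker => /eqP ->; rewrite linear0.
have -> : w = transgression psi; last exact: memv_img.
apply/lfunP => x; apply/lfunP => y; have [u <-] := onto_lfun x.
by have [v <-] := onto_lfun y; rewrite transgressionE // psiE.
Qed.

(** Cocycles and coboundaries are the images of the annihilators of [KR] and of
    [R]. As [R] is inside the derived algebra, both annihilators contain the
    annihilator of the derived algebra, which is the kernel, so their dimensions
    differ by [b2 g]. *)
Lemma hopf_formula : b2 g = dim_quot R KR.
Proof.
have annR : (annihilator R <= annihilator KR)%VS.
  exact/annihilatorS/lie_vprod_lker.
have kerE U : (annihilator (lie_vprod fullv fullv) <= U)%VS ->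
    (U <= annihilator KR)%VS ->
    (U :&: lker transgression = annihilator (lie_vprod fullv fullv))%VS.
  move=> KKU UKR; apply/vspaceP => psi; rewrite memv_cap memv_ker.
  apply/andP/idP => [[Upsi /eqP psi0]|psi0].
    by apply/transgression_eq0 => //; exact: (subvP UKR).
  have Upsi := subvP KKU _ psi0; split=> //.
  by apply/eqP/transgression_eq0 => //; exact: (subvP UKR).
have annKK := annihilatorS R_sub.
have e1 := limg_ker_dim transgression (annihilator KR).
have e2 := limg_ker_dim transgression (annihilator R).
rewrite kerE ?(subv_trans annKK) // -transgression_cocycle2 in e1.
rewrite kerE // -transgression_coboundary in e2.
have B_Z : (vspan (@coboundary2 k g) <= vspan (@cocycle2 k g))%VS.
  by rewrite transgression_cocycle2 transgression_coboundary limgS.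
have e3 := dim_quotS B_Z; have e4 := dim_quotS lie_vprod_lker.
have e5 := dim_annihilator KR; have e6 := dim_annihilator R.
rewrite /b2; move: e1 e2 e3 e4 e5 e6.
set a := \dim (annihilator _); set b := \dim (annihilator _).
set c := \dim (annihilator _); lia.
Qed.

End Hopf.

(** * A criterion for central extensions of class p + 1 *)

Section Criterion.
Variables (k : fieldType) (n p : nat) (g : finLieType k).
Hypotheses (p_gt0 : (0 < p)%N) (g_nil : lcs g p.+1 = [set 0]).
Local Notation K := (freeNil k n p.+1).
Variable pi : 'Hom(K, g).
Hypotheses (pi_lie : lie_morph pi) (pi_onto : limg pi = fullv).
Local Notation R := (lker pi).
Local Notation KR := (lie_vprod fullv R).

Let KR_ideal : lie_ideal [set` KR].
Proof.
split=> [|x y KRy]; first exact: submod_vspace.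
apply: mem_lie_vprodM; rewrite ?memvf //.
exact: (subvP (lie_vprod_lker pi_lie)).
Qed.

Lemma central_lift (E : finLieType k) (rho : 'Hom(E, g)) :
    lie_morph rho -> limg rho = fullv ->
    (forall x, rho x = 0 -> lie_center E x) ->
  exists2 h : 'Hom(K, E), lie_morph h & forall u, rho (h u) = pi u.
Proof.
move=> rho_lie rho_onto rho_central; apply: freeNil_lift => //.
exact: (lcs_central rho_lie rho_central g_nil).
Qed.

Lemma cocycle_ext_lift (w : {w : bilform g | cocycle2 w}) :
  exists2 h : 'Hom(K, cocycle_ext w),
    lie_morph h & forall u, (h u).1 = pi u.
Proof.
have fst_linear : linear (fun u : (cocycle_ext w : finLieType k) => u.1) by [].
have [rho rhoE] := linear_lfun fst_linear.
have [|||h h_lie hE] := central_lift (rho := rho).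
- by move=> u v; rewrite !rhoE.
- apply/eqP; rewrite eqEsubv subvf; apply/subvP => x _.
  by apply/memv_imgP; exists ((x, 0) : cocycle_ext w); rewrite ?memvf ?rhoE.
- by move=> u; rewrite rhoE; exact: cocycle_ext_central.
by exists h => // u; rewrite -hE rhoE.
Qed.

(** [K / KR] is the test object: it is itself a central extension of [g], of
    class [p.+1] unless [KR] swallows [lcs K p.+1]; and a lift of [pi] to any
    other central extension kills [KR] and is onto modulo the centre, so that it
    maps [lcs K p.+1] onto the corresponding term. *)
Lemma central_extension_criterion :
  has_central_extension g p.+1 <->
  ~ (forall u, lcs K p.+1 u -> u \in KR).
Proof.
split=> [[E [M [rho [[rho_lie kerM rho_onto] Mcentral [_ E_p E_nil]]]]] K_KR|].
  apply: E_p; apply/lcs0P => x; rewrite -(prednK p_gt0).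
  have [h h_lie hE] := freeNil_lift rho_lie pi_lie rho_onto E_nil.
  move=> /(lcs_lift h_lie)[].
    move=> y; have [u uy] := onto_lfun pi_onto (rho y); exists u.
    by apply: Mcentral; rewrite /= -kerM memv_ker linearB /= hE uy subrr.
  move=> u; rewrite (prednK p_gt0) => /K_KR uKR <-.
  apply/eqP; rewrite -memv_ker; move: u uKR; apply/subvP.
  apply: lie_vprod_sub => u v _ Rv; rewrite memv_ker h_lie.
  rewrite (lie_center_sym (h u)) //; apply: Mcentral.
  by rewrite /= -kerM memv_ker hE -memv_ker.
move=> K_KR; pose I := LieIdeal KR_ideal; pose E := finQuot I.
pose f (u : E) := pi (repr u).
have fE u : f (quot_map I u) = pi u.
  apply/eqP; rewrite quot_mapE -subr_eq0 -linearB -memv_ker.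
  by apply: (subvP (lie_vprod_lker pi_lie)); exact: (repr_quotI I).
have f_linear : linear f.
  move=> a x y; have [u <-] := quot_map_onto x; have [v <-] := quot_map_onto y.
  by rewrite -linearP !fE linearP.
have [rho rhoE] := linear_lfun f_linear.
exists E, (lker rho), rho; split; first split=> //.
- move=> x y; have [u <-] := quot_map_onto x; have [v <-] := quot_map_onto y.
  by rewrite -quot_map_lie !rhoE !fE pi_lie.
- apply/eqP; rewrite eqEsubv subvf; apply/subvP => x _.
  have [u <-] := onto_lfun pi_onto x; apply/memv_imgP.
  by exists (quot_map I u); rewrite ?memvf // rhoE fE.
- move=> x; have [u <-] := quot_map_onto x.
  rewrite /= memv_ker rhoE fE -memv_ker => Ru y.
  have [v <-] := quot_map_onto y; rewrite -quot_map_lie.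
  apply/quot_map_eq0; rewrite /= lieC memvN.
  by apply: mem_lie_vprodM; rewrite ?memvf.
- split=> //.
  move=> /lcs0P E_p; apply: K_KR => u Ku.
  apply: (quot_map_eq0 I u).1; apply: E_p.
  exact: (lcs_morph (@quot_map_lie _ _ I)).
- apply/lcs0P => x /(lcs_onto (@quot_map_lie _ _ I) (@quot_map_onto _ _ I)).
  by case=> u; rewrite freeNil_nilpotent => -> <-; rewrite linear0.
Qed.

End Criterion.

Section Truncation.
Variables (k : fieldType) (n p : nat).
Local Notation K := (freeNil k n p.+1).
Local Notation F := (freeNil k n p).

Lemma freeNil_truncation : exists q : 'Hom(K, F),
  [/\ lie_morph q, forall x, q (freeNil_proj p.+1 x) = freeNil_proj p x
    & limg q = fullv].
Proof.
have F0 : lcs F p.+2 = [set 0].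
  by apply/lcs0P => x /lcs_desc; rewrite freeNil_nilpotent.
have [q q_lie qE] := freeNil_factor (@freeNil_proj_lie k n p) F0.
exists q; split=> //; apply/eqP; rewrite eqEsubv subvf; apply/subvP => u _.
have [x ->] := freeNil_projP u; apply/memv_imgP.
by exists (freeNil_proj p.+1 x); rewrite ?memvf.
Qed.

Lemma lker_truncation (q : 'Hom(K, F)) u : lie_morph q ->
    (forall x, q (freeNil_proj p.+1 x) = freeNil_proj p x) ->
  u \in lker q <-> lcs K p.+1 u.
Proof.
move=> q_lie qE; rewrite memv_ker; split=> [/eqP|]; last first.
  by move/(lcs_morph q_lie); rewrite freeNil_nilpotent => ->.
have [x ->] := freeNil_projP u; rewrite qE => /freeNil_proj_eq0.
exact: (lcs_morph (@freeNil_proj_lie k n p.+1)).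
Qed.

End Truncation.

(** Taking images under [q] lowers the dimension of [R] by the whole kernel and
    that of [S] by the part of the kernel inside [S] only. *)
Lemma dim_quot_img_lt (k : fieldType) (V W : vectType k) (q : 'Hom(V, W))
    (R S : {vspace V}) : (S <= R)%VS -> (lker q <= R)%VS ->
  (dim_quot (q @: R) (q @: S) < dim_quot R S)%N <-> ~ (lker q <= S)%VS.
Proof.
move=> SR ZR.
have e1 := limg_ker_dim q R; have e2 := limg_ker_dim q S.
have e3 := dim_quotS SR; have e4 := dim_quotS (limgS q SR).
have le := dimvS SR; have leZ := dimvS (capvSr S (lker q)).
have eqZ : (\dim (S :&: lker q) == \dim (lker q)) = (lker q <= S)%VS.
  apply/eqP/idP => [e|/capv_idPr -> //].
  by apply/capv_idPr/eqP; rewrite eqEdim capvSr e leqnn.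
rewrite (capv_idPr ZR) in e1.
split=> [lt sub|nsub].
  by move: eqZ; rewrite sub => /eqP; lia.
have : \dim (S :&: lker q) != \dim (lker q) by rewrite eqZ; apply/negP.
lia.
Qed.

(** * A metabelian Lie algebra over polynomials *)

Section Metabelian.
Variable k : fieldType.

(** The semidirect product of a plane with a polynomial ring, twisted by the
    area form: writing [s] for the outer variable and [c] for the inner one, the
    basis vectors of the plane act on polynomials as [s] and [c * s], and their
    bracket is the polynomial [1]. The ring [k[s, c * s]] is thus the derived
    algebra of the free metabelian Lie algebra on two generators, and the
    exponent of [s] is the degree of a form in the two operators. *)
Definition metab := (k * k * {poly {poly k}})%type.
HB.instance Definition _ :=
  GRing.Zmodule.copy metab (k * k * {poly {poly k}})%type.
Implicit Types u v w : metab.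

Let mscale (a : k) u : metab := (a * u.1.1, a * u.1.2, a%:P%:P * u.2).

Let mscaleA a b u : mscale a (mscale b u) = mscale (a * b) u.
Proof. by rewrite /mscale /= !mulrA !polyCM. Qed.

Let mscale1 : left_id 1 mscale.
Proof. by move=> [[a b] f]; rewrite /mscale /= !mul1r. Qed.

Let mscaleDr : right_distributive mscale +%R.
Proof. by move=> a u v; rewrite /mscale /= !mulrDr. Qed.

Let mscaleDl u : {morph mscale^~ u : a b / a + b}.
Proof. by move=> a b; rewrite /mscale /= !polyCD !mulrDl. Qed.

HB.instance Definition _ := GRing.Zmodule_isLmodule.Build k metab
  mscaleA mscale1 mscaleDr mscaleDl.

Definition weight u : {poly {poly k}} :=
  (u.1.1%:P + u.1.2%:P * 'X)%:P * 'X.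

Definition area u v : {poly {poly k}} :=
  (u.1.1 * v.1.2 - u.1.2 * v.1.1)%:P%:P.

Let mlie u v : metab := (0, 0, area u v + weight u * v.2 - weight v * u.2).

Let mlie_linearl a u v w : mlie (a *: u + v) w = a *: mlie u w + mlie v w.
Proof.
rewrite /mlie; congr (_, _, _) => /=; rewrite ?mulr0 ?addr0 //.
rewrite /weight /area /=; ring.
Qed.

Let mlie_linearr a u v w : mlie w (a *: u + v) = a *: mlie w u + mlie w v.
Proof.
rewrite /mlie; congr (_, _, _) => /=; rewrite ?mulr0 ?addr0 //.
rewrite /weight /area /=; ring.
Qed.

Let mliexx u : mlie u u = 0.
Proof. rewrite /mlie; congr (_, _, _); rewrite /weight /area /=; ring. Qed.

Let mlie_jacobi u v w :
  mlie u (mlie v w) + mlie v (mlie w u) + mlie w (mlie u v) = 0.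
Proof.
rewrite /mlie; congr (_, _, _); rewrite /weight /area /= ?addr0 //; ring.
Qed.

HB.instance Definition _ := isLie.Build k metab
  mlie_linearl mlie_linearr mliexx mlie_jacobi.

Lemma metab_lieE u v :
  [< u, v >] = (0, 0, area u v + weight u * v.2 - weight v * u.2) :> metab.
Proof. by []. Qed.

End Metabelian.

(** * Multiples of one polynomial *)

Section LowestCoefficient.
Variable A : idomainType.
Implicit Types f : {poly A}.

Lemma lowest_coef f : f != 0 ->
  exists d f1, f1`_0 != 0 /\ f = f1 * 'X^d.
Proof.
move=> f0; have [d [f1]] := multiplicity_XsubC f 0.
rewrite f0 polyC0 subr0 /= => f10 ->; exists d, f1; split=> //.
by rewrite -horner_coef0.
Qed.

Lemma lowest_coef_uniq (a b : {poly A}) i j : a`_0 != 0 -> b`_0 != 0 ->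
  a * 'X^i = b * 'X^j -> i = j /\ a = b.
Proof.
wlog le_ij : a b i j / (i <= j)%N => [hw a0 b0 e|a0 b0].
  case: (leqP i j) => [ij|/ltnW ji]; first exact: hw.
  by have [-> ->] := hw b a j i ji b0 a0 (esym e).
rewrite -(subnK le_ij) exprD mulrA => /(mulIf (monic_neq0 (monicXn A i))) e.
move: a0; rewrite e coefMXn; case: posnP => [ij _|_]; last by rewrite eqxx.
by rewrite ij expr0 mulr1.
Qed.

(** Lowest terms multiply over a domain. *)
Lemma lowest_coef_mul (f1 h r : {poly A}) (a : A) d m : f1`_0 != 0 -> a != 0 ->
    h * (f1 * 'X^d) = (a%:P + r * 'X) * 'X^m ->
  exists2 e, (e + d)%N = m & h`_e * f1`_0 = a.
Proof.
move=> f10 a0 e.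
have ar0 : (a%:P + r * 'X)`_0 = a by rewrite coefD coefC coefMX addr0.
have h0 : h != 0.
  apply: contraNneq a0 => h0; rewrite -ar0.
  move/esym/eqP: e; rewrite h0 mul0r mulf_eq0.
  by rewrite (negPf (monic_neq0 (monicXn A m))) orbF => /eqP ->; rewrite coef0.
have [i [h1 [h10 hE]]] := lowest_coef h0.
move: e; rewrite hE -mulrA [_ * (f1 * _)]mulrCA -exprD mulrA.
case/lowest_coef_uniq; rewrite ?coef0M ?mulf_neq0 ?ar0 //.
move=> <- e; exists i => //.
by rewrite coefMXn ltnn subnn -coef0M e ar0.
Qed.

End LowestCoefficient.

Section Multiples.
Variable k : fieldType.

(** Membership in [k[s, c * s]]: a form of degree [i] in [s] and [c * s] is
    [s ^+ i] times a polynomial in [c] of degree at most [i]. *)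
Definition subdiagonal (f : {poly {poly k}}) :=
  forall i, (size (f`_i)%R <= i.+1)%N.

Lemma subdiagonalD f h : subdiagonal f -> subdiagonal h -> subdiagonal (f + h).
Proof.
move=> bf bh i; rewrite coefD (leq_trans (size_polyD _ _)) //.
by rewrite geq_max bf bh.
Qed.

Lemma subdiagonalM f h : subdiagonal f -> subdiagonal h -> subdiagonal (f * h).
Proof.
move=> bf bh i; rewrite coefM; apply: (leq_trans (size_sum _ _ _)).
apply/bigmax_leqP => j _; apply: (leq_trans (size_polyMleq _ _)).
have := bf j; have := bh (i - j)%N; have := ltn_ord j; lia.
Qed.

Lemma subdiagonalC (a : k) : subdiagonal a%:P%:P.
Proof.
by case=> [|i]; rewrite coefC /= ?size_poly0 // (leq_trans (size_polyC_leq1 a)).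
Qed.

Lemma subdiagonal_weight u : subdiagonal (weight u).
Proof.
move=> i; rewrite /weight coefMX coefC.
case: i => [|[|i]] /=; rewrite ?size_poly0 //.
rewrite (leq_trans (size_polyD _ _)) // geq_max.
rewrite (leq_trans (size_polyC_leq1 _)) //=.
rewrite (leq_trans (size_polyMleq _ _)) // size_polyX addn2 ltnS.
exact: size_polyC_leq1.
Qed.

Lemma submod_subdiagonal : submod [set u : metab k | subdiagonal u.2].
Proof.
split=> [i|a u v bu bv]; first by rewrite coef0 size_poly0.
by apply: subdiagonalD => //; apply: subdiagonalM => //; exact: subdiagonalC.
Qed.

Lemma subdiagonal_lie (u v : metab k) :
  subdiagonal u.2 -> subdiagonal v.2 -> subdiagonal ([< u, v >] : metab k).2.
Proof.
move=> bu bv; rewrite metab_lieE /=; apply: subdiagonalD.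
  apply: subdiagonalD; first exact: subdiagonalC.
  by apply: subdiagonalM => //; exact: subdiagonal_weight.
rewrite -mulN1r -!polyCN; apply: subdiagonalM; first exact: subdiagonalC.
by apply: subdiagonalM => //; exact: subdiagonal_weight.
Qed.

Lemma lcs_metab i (u : metab k) : lcs (metab k) i.+2 u ->
  u.1 = (0, 0) /\ exists h, u.2 = h * 'X^i.
Proof.
have sS j : submod [set u : metab k | u.1 = (0, 0) /\ exists h, u.2 = h * 'X^j].
  split; first by split=> //; exists 0; rewrite mul0r.
  move=> a [[_ _] _] [[_ _] _] [[-> ->] [h /= ->]] [[-> ->] [h' /= ->]].
  split; first by congr (_, _); rewrite /= mulr0 addr0.
  by exists (a%:P%:P * h + h'); rewrite mulrDl mulrA.
elim: i u => [|i IH] u; rewrite lcsS; move: u.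
  apply: lie_prod_sub; first exact: sS.
  by move=> u v _ _; split=> //; exists ([< u, v >] : metab k).2; rewrite mulr1.
apply: lie_prod_sub; first exact: sS.
move=> u v _ Lv.
have [v1 [h vE]] := IH v Lv; split=> //.
exists ((u.1.1%:P + u.1.2%:P * 'X)%:P * h).
by rewrite metab_lieE /= /area /weight vE v1 /= exprSr; set t := 'X^i; ring.
Qed.

Lemma lie_ideal_multiples (f : {poly {poly k}}) :
  lie_ideal [set u : metab k | u.1 = (0, 0) /\
    exists2 h, subdiagonal h & u.2 = h * f].
Proof.
split; first split.
- split=> //; exists 0; rewrite ?mul0r // => i.
  by rewrite coef0 size_poly0.
- move=> a [[_ _] _] [[_ _] _] [[-> ->] [h bh /= ->]] [[-> ->] [h' bh' /= ->]].
  split; first by congr (_, _); rewrite /= mulr0 addr0.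
  exists (a%:P%:P * h + h'); last by rewrite mulrDl mulrA.
  by apply: subdiagonalD => //; apply: subdiagonalM => //; exact: subdiagonalC.
- move=> u v [v1 [h bh vE]]; split=> //; exists (weight u * h).
    by apply: subdiagonalM => //; exact: subdiagonal_weight.
  by rewrite metab_lieE /= /area /weight vE v1 /=; ring.
Qed.

Lemma size_factors (a b c : {poly k}) :
  a * b = c -> c != 0 -> (0 < size b /\ size a + size b = (size c).+1)%N.
Proof.
move=> <-; rewrite mulf_eq0 negb_or => /andP[a0 b0]; rewrite size_mul //.
split; first by rewrite size_poly_gt0.
by rewrite prednK // addn_gt0 size_poly_gt0 a0.
Qed.

(** Suppose that both [s ^+ m] and [(c * s) ^+ m] are the lowest terms of
    multiples of [f], and let [a * s ^+ d] be the lowest term of [f]. The first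
    multiple shows that [a] is a constant. In the second, the lowest coefficient
    of the cofactor [h'] is then [c ^+ m] up to a scalar and sits at
    [s ^+ (m - d)], which [h'] allows for [d = 0] only: but [f] has no constant
    term. *)
Lemma monomials_not_multiples (f h h' r r' : {poly {poly k}}) m :
  f`_0 = 0 -> subdiagonal h' ->
  h * f = (1 + r * 'X) * 'X^m -> h' * f = (('X^m)%:P + r' * 'X) * 'X^m -> False.
Proof.
move=> f0 bh' e e'.
have [fE|fn0] := eqVneq f 0.
  move: e; rewrite fE mulr0 => /(congr1 (fun q : {poly {poly k}} => q`_m))/eqP.
  by rewrite coef0 coefMXn ltnn subnn coefD coef1 coefMX addr0 eq_sym oner_eq0.
have [d [f1 [f10 fE]]] := lowest_coef fn0; rewrite fE in e e' f0.
have [i _ hi] := lowest_coef_mul f10 (oner_neq0 _) e.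
have [j jd hj] := lowest_coef_mul f10 (monic_neq0 (monicXn k m)) e'.
have d_gt0 : (0 < d)%N.
  by case: d f0 {fE e e' jd} => // /eqP; rewrite mulr1 (negPf f10).
have [f1_gt0 e1] := size_factors hi (oner_neq0 _).
have [_ e2] := size_factors hj (monic_neq0 (monicXn k m)).
have hi_gt0 : (0 < size (h`_i)%R)%N.
  rewrite size_poly_gt0; apply: contra_eq_neq hi => ->.
  by rewrite mul0r eq_sym oner_neq0.
have := bh' j; move: f1_gt0 e1 e2 hi_gt0; rewrite size_poly1 size_polyXn.
set x := size (f1`_0); set y := size (h`_i); set z := size (h'`_j).
lia.
Qed.
End Multiples.

(** * Lie algebras with one relator *)

Section MetabelianImage.
Variables (k : fieldType) (n : nat).
Local Notation L := (freeLie k n).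
Implicit Types a b : 'I_n -> k.

Definition metab_map a b : L -> metab k :=
  free_lift (fun i => (a i, b i, 0) : metab k).
HB.instance Definition _ a b := GRing.Linear.copy (metab_map a b) (free_lift _).

Lemma metab_map_lie a b : lie_morph (metab_map a b).
Proof. exact: free_lift_lie. Qed.

Lemma metab_map_gen a b i : metab_map a b (free_gen k i) = (a i, b i, 0).
Proof. exact: free_lift_gen. Qed.

Lemma subdiagonal_metab_map a b x : subdiagonal (metab_map a b x).2.
Proof.
elim/freeLie_ind: x => [i||x y bx by_].
- by rewrite metab_map_gen => j; rewrite coef0 size_poly0.
- exact: (submod_preimage (metab_map a b) (submod_subdiagonal k)).
- by rewrite metab_map_lie; exact: subdiagonal_lie.
Qed.

Lemma metab_lie_coef0 (u v : metab k) :
  ([< u, v >] : metab k).2`_0 = (u.1.1 * v.1.2 - u.1.2 * v.1.1)%:P.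
Proof.
rewrite metab_lieE /= coefB coefD !coef0M !coefX /=.
by rewrite !mulr0 !mul0r subr0 addr0 coefC.
Qed.

(** The constant term of a bracket is the determinant of the weights of its two
    factors, so it is linear in the weights on the second axis when those on the
    first are fixed. The induction has to carry the weights along. *)
Lemma metab_map_linear a b c s x :
  let d i := s * b i + c i in
  [/\ (metab_map a d x).1.1 = (metab_map a b x).1.1,
      (metab_map a d x).1.1 = (metab_map a c x).1.1,
      (metab_map a d x).1.2 =
        s * (metab_map a b x).1.2 + (metab_map a c x).1.2
    & (metab_map a d x).2`_0 =
        s%:P * (metab_map a b x).2`_0 + (metab_map a c x).2`_0].
Proof.
move=> d; elim/freeLie_ind: x => [i||x y [x1 x2 x3 x4] [y1 y2 y3 y4]].
- by rewrite !metab_map_gen /= coef0 mulr0 addr0.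
- split=> [|t x y [x1 x2 x3 x4] [y1 y2 y3 y4]].
    by rewrite !linear0 /= coef0 !mulr0 !addr0.
  rewrite !linearP /= x1 y1 -x2 -y2 x1 y1 x3 y3 !coefD !coefCM x4 y4.
  split=> //; ring.
- rewrite !metab_map_lie !metab_lie_coef0 /= -x2 -y2 x1 y1 x3 y3.
  split=> //; ring.
Qed.

(** The ideal generated by [X] goes to the multiples of the polynomial [f] of
    [X], and [lcs L m.+3] to the multiples of [s ^+ m.+1]. Applying [x] or [y]
    [m] times to [[x, y]] gives elements of [lcs L m.+2] whose images are
    [s ^+ m] and [(c * s) ^+ m], so both would be multiples of [f] up to higher
    order. *)
Lemma isotropic_one_relator a b x y X m :
    metab_map a b x = (1, 0, 0) -> metab_map a b y = (0, 1, 0) ->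
    lcs L 2 X -> (metab_map a b X).2`_0 = 0 ->
  ~ (forall z, lcs L m.+2 z ->
       exists2 j, ideal_gen [set X] j & lcs L m.+3 (z - j)).
Proof.
move=> xE yE LX X0 covered; pose theta_lie := metab_map_lie a b.
have [X1 _] := lcs_metab (lcs_morph theta_lie LX).
have gens z w : metab_map a b z = (w, 0) ->
    let u := iter m (lie z) [< x, y >] in
    lcs L m.+2 u /\ metab_map a b u = (0, 0, weight (w, 0) ^+ m).
  move=> zE; elim: m {covered} => [|i [Li IH]] /=.
    split; first exact: lcs_lie.
    rewrite theta_lie xE yE metab_lieE /area /weight /=.
    by congr (_, _); rewrite expr0; ring.
  split; first exact: lcs_lie.
  rewrite theta_lie zE IH metab_lieE /area /weight /= exprS.
  by congr (_, _); rewrite !mulr0 subrr; ring.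
have cover z u : lcs L m.+2 z -> metab_map a b z = (0, 0, u) ->
    exists2 h, subdiagonal h & exists r : {poly {poly k}},
      h * (metab_map a b X).2 = u - r * 'X^(m.+1).
  move=> Lz zE; have [j Jj Lzj] := covered z Lz.
  have : (metab_map a b @^-1` [set u | u.1 = (0, 0) /\
            exists2 h, subdiagonal h & u.2 = h * (metab_map a b X).2]) j.
    apply: Jj; split; last first.
      move=> _ ->; split=> //; exists 1; rewrite ?mul1r // -[1]/(1%:P%:P).
      exact: subdiagonalC.
    apply: (lie_ideal_preimage theta_lie); exact: lie_ideal_multiples.
  case=> _ [h bh jE]; exists h => //.
  have [_ [r]] := lcs_metab (lcs_morph theta_lie Lzj).
  rewrite linearB /= zE => rE; exists r.
  by rewrite -rE /= -jE opprB addrC subrK.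
have [Lu uE] := gens x _ xE; have [Lv vE] := gens y _ yE.
have [h _ [r hE]] := cover _ _ Lu uE; have [h' bh' [r' hE']] := cover _ _ Lv vE.
apply: (monomials_not_multiples (h := h) (r := - r) (r' := - r') (m := m)
  X0 bh').
  rewrite hE /weight /= mul0r addr0 mul1r exprS; ring.
rewrite hE' /weight /= add0r mul1r exprMn -polyC_exp exprS; ring.
Qed.

End MetabelianImage.

Section OneRelatorCases.
Variables (k : fieldType) (n : nat).
Local Notation L := (freeLie k n).
Local Notation coordinate i := (fun j : 'I_n => (j == i)%:R : k).

Lemma metab_map_coef0 (a b : 'I_n -> k) X :
  (metab_map a b X).2`_0 = ((metab_map a b X).2`_0`_0)%:P.
Proof. by apply: size1_polyC; exact: subdiagonal_metab_map. Qed.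

(** The constant term pairs two weights bilinearly. With the first weight fixed
    it is one linear condition on the second, and this has a nonzero solution in
    the plane of the two other coordinates. *)
Lemma rank3_isotropic (i0 i1 i2 : 'I_n) (X : L) :
    i1 != i0 -> i2 != i0 -> i2 != i1 ->
  exists a b x y, [/\ metab_map a b x = (1, 0, 0), metab_map a b y = (0, 1, 0)
    & (metab_map a b X).2`_0 = 0].
Proof.
move=> n10 n20 n21.
have [u0|un0] := eqVneq ((metab_map (coordinate i0) (coordinate i1) X).2`_0) 0.
  exists (coordinate i0), (coordinate i1), (free_gen k i0), (free_gen k i1).
  by rewrite !metab_map_gen !eqxx (negPf n10) eq_sym (negPf n10).
pose u := (metab_map (coordinate i0) (coordinate i1) X).2`_0`_0.
pose v := (metab_map (coordinate i0) (coordinate i2) X).2`_0`_0.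
have u_neq0 : u != 0.
  by apply: contraNneq un0 => u0; rewrite metab_map_coef0 -/u u0.
exists (coordinate i0), (fun i => - (v / u) * (i == i1)%:R + (i == i2)%:R).
exists (free_gen k i0), (free_gen k i2); split.
- rewrite metab_map_gen eqxx eq_sym (negPf n10) eq_sym.
  by rewrite (negPf n20) mulr0 addr0.
- by rewrite metab_map_gen eqxx (negPf n20) (negPf n21) mulr0 add0r.
have [_ _ _ ->] := metab_map_linear (coordinate i0) (coordinate i1)
  (coordinate i2) (- (v / u)) X.
rewrite metab_map_coef0 -/u [X in _ + X]metab_map_coef0 -/v -polyCM -polyCD.
by rewrite mulNr divfK // addNr.
Qed.

Variables i0 i1 : 'I_n.
Hypotheses (n10 : i1 != i0) (all_i : forall i, i = i0 \/ i = i1).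
Local Notation f := (metab_map (coordinate i0) (coordinate i1)).
Local Notation x0 := (free_gen k i0).
Local Notation x1 := (free_gen k i1).

Lemma rank2_generators (z : L) : exists2 r, lcs L 2 r
  & z = (f z).1.1 *: x0 + (f z).1.2 *: x1 + r.
Proof.
have [S0 SL] := submod_lcs L 2.
elim/freeLie_ind: z => [i||x y _ _].
- exists 0 => //; rewrite metab_map_gen /= addr0.
  case: (all_i i) => ->; rewrite eqxx;
    rewrite ?(negPf n10) ?[i0 == _]eq_sym ?(negPf n10).
    by rewrite scale1r scale0r addr0.
  by rewrite scale1r scale0r add0r.
- split=> [|s x y [r Lr xE] [r' Lr' yE]].
    by exists 0; rewrite // linear0 !scale0r !addr0.
  exists (s *: r + r'); first exact: SL.
  rewrite linearP /=; move: xE yE.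
  case: (f x) (f y) => [[a b] ?] [[c d] ?] /= -> ->.
  rewrite !scalerDl -!scalerA !scalerDr [LHS]addrACA; congr (_ + _).
  by rewrite [LHS]addrACA.
- exists [< x, y >]; first exact: lcs_lie.
  by rewrite metab_map_lie metab_lieE /= !scale0r !add0r.
Qed.

Lemma rank2_bracket (z : L) : lcs L 2 z ->
  lcs L 3 (z - (f z).2`_0`_0 *: [< x0, x1 >]).
Proof.
have sL := submod_lcs L 3; have [S0 SL] := sL.
move: z; apply: lie_prod_sub.
  split=> [|s x y Lx Ly]; first by rewrite /= linear0 /= !coef0 scale0r subr0.
  rewrite /= linearP /= coefD coefCM coefD coefCM scalerDl -scalerA.
  by rewrite opprD addrACA -scalerBr; exact: SL.
move=> x y _ _; rewrite metab_map_lie metab_lie_coef0 coefC /=.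
have [r Lr xE] := rank2_generators x; have [t Lt yE] := rank2_generators y.
move: xE yE; set a := (f x).1.1; set b := (f x).1.2.
set c := (f y).1.1; set d := (f y).1.2 => xE yE.
have -> : [< x, y >] - (a * d - b * c) *: [< x0, x1 >] =
          [< a *: x0 + b *: x1, t >] - [< y, r >].
  rewrite (lieC y r) opprK {1}xE lieDl addrAC; congr (_ + _).
  rewrite {1}yE lieDr addrAC -[RHS]add0r; congr (_ + _).
  rewrite !lieDl !lieDr !lieZl !lieZr !liexx (lieC x1 x0) !scaler0 add0r addr0.
  by rewrite !scalerN !scalerA -scalerBl subrr.
by apply: (submodB sL); exact: lcs_lie.
Qed.

(** With two generators the bracket [[x0, x1]] spans [lcs L 2] modulo [lcs L 3],
    and the constant term reads off its coefficient. *)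
Lemma rank2_relator (X : L) : lcs L 2 X -> (f X).2`_0 != 0 ->
  forall z, lcs L 2 z -> exists s, lcs L 3 (z - s *: X).
Proof.
move=> LX Xn0 z Lz; pose c := (f X).2`_0`_0; pose d := (f z).2`_0`_0.
have cn0 : c != 0.
  by apply: contraNneq Xn0 => c0; rewrite metab_map_coef0 -/c c0.
(* The combination of [z] and [X] in which [[x0, x1]] cancels. *)
exists (d / c); have sL := submod_lcs L 3.
have := submodB sL (rank2_bracket Lz) (submodZ (d / c) sL (rank2_bracket LX)).
by rewrite -/c -/d scalerBr scalerA divfK // opprB addrA subrK.
Qed.

End OneRelatorCases.

Lemma low_rank_line (k : fieldType) n : (n <= 1)%N ->
  exists z : freeLie k n, forall x, exists a, x = a *: z.
Proof.
move=> n_le1.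
have [z zE] : exists z : freeLie k n, forall i, free_gen k i = z.
  case: n n_le1 => [|[|//]] _; first by exists 0 => -[].
  by exists (free_gen k ord0) => i; rewrite ord1.
exists z; apply: freeLie_ind => [i||x y [a ->] [b ->]].
- by exists 1; rewrite scale1r zE.
- split=> [|s x y [a ->] [b ->]]; first by exists 0; rewrite scale0r.
  by exists (s * a + b); rewrite scalerDl scalerA.
- by exists 0; rewrite lieZl lieZr liexx !scaler0 scale0r.
Qed.

Section OneRelatorQuotient.
Variables (k : fieldType) (g : finLieType k) (n p : nat).
Local Notation L := (freeLie k n).
Local Notation F := (freeNil k n p).
Local Notation K := (freeNil k n p.+1).
Variables (pi : 'Hom(F, g)) (X : F).
Hypotheses (pi_lie : lie_morph pi) (pi_onto : limg pi = fullv).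
Hypotheses (X2 : lcs F 2 X) (N_gen : [set` lker pi] = ideal_gen [set X]).
Hypotheses (g_class : nilpotent_class g p) (n_gt1 : (1 < n)%N).
Variable q : 'Hom(K, F).
Hypotheses (q_lie : lie_morph q)
  (qE : forall x, q (freeNil_proj p.+1 x) = freeNil_proj p x).

(** In a nilpotent algebra the lower central series stops at [0] as soon as it
    is stationary. *)
Lemma lcs2_neq_lcs3 : (1 < p)%N -> ~ (lcs g 2 `<=` lcs g 3).
Proof.
case: g_class => p_gt0 gp gS p_gt1 sub23; apply: gp; apply/lcs0P => x.
have stable i : lcs g 2 `<=` lcs g i.+2.
  elim: i => [//|i IH] y /sub23; rewrite lcsS.
  apply: lie_prod_sub; first exact: submod_lcs.
  by move=> u v _ /IH; exact: lcs_lie.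
rewrite -(ltn_predK p_gt1) => /(lcs_le (i := 1)) x2.
have := stable p.-1 x; rewrite prednK // gS => x0; apply: x0; apply: x2.
by rewrite -ltnS prednK.
Qed.

(** Were [lcs K p.+1] contained in [[K, R]], each element of [lcs L p.+1] would
    lie in [J] up to [lcs L p.+2], where [J] is the ideal of [L] generated by a
    lift [Y] of [X]. The metabelian image of [Y] then gives a contradiction, as
    soon as two weights make its constant term vanish. *)
Lemma one_relator_uncovered :
  ~ (forall u, lcs K p.+1 u -> u \in lie_vprod fullv (lker (pi \o q))).
Proof.
case: (g_class) => p_gt0 _ gS K_KR.
(* For [p = 1] the vector [X] is [0] and only the lift [Y = 0] has a constant
   term that is sure to vanish. *)
have [Y [Y2 YX Yp]] :
    exists Y, [/\ lcs L 2 Y, freeNil_proj p Y = X & p = 1%N -> Y = 0].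
  have [p1|pn1] := eqVneq p 1%N; last first.
    have [Y LY YX] := lcs_freeNil X2; exists Y; split=> // p1.
    by rewrite p1 in pn1.
  exists 0; split=> //; first by case: (submod_lcs L 2).
  have F2 : lcs F 2 = lcs F p.+1 by congr lcs; rewrite p1.
  by move: X2; rewrite linear0 F2 freeNil_nilpotent => ->.
pose J := ideal_gen [set Y]; have idJ : lie_ideal J := lie_ideal_gen _.
have NJ (u : F) : u \in lker pi -> (freeNil_proj p @` J) u.
  move=> Nu; have : ideal_gen [set X] u by rewrite -N_gen.
  apply; split; last by move=> _ ->; exists Y => //; apply: sub_gen_smallest.
  exact: (lie_ideal_image (@freeNil_proj_lie k n p)
    (@freeNil_proj_onto k n p) idJ).
have covered z : lcs L p.+1 z -> exists2 j, J j & lcs L p.+2 (z - j).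
  move=> /(lcs_morph (@freeNil_proj_lie k n p.+1))/K_KR/mem_lie_vprod zKR.
  have : (freeNil_proj p.+1 @` J) (freeNil_proj p.+1 z).
    move: zKR; apply: lie_prod_sub.
      exact: (submod_image (@freeNil_proj k n p.+1) idJ.1).
    move=> u v _; rewrite /= memv_ker comp_lfunE -memv_ker => /NJ[j Jj jv].
    have [x ->] := freeNil_projP u; exists [< x, j >]; first exact: idJ.2.
    rewrite freeNil_proj_lie; apply/eqP; rewrite -subr_eq0 -lieNr -lieDr.
    have : lcs K p.+2 [< freeNil_proj p.+1 x, freeNil_proj p.+1 j - v >].
      apply: lcs_lie; apply/(lker_truncation _ q_lie qE).
      by rewrite memv_ker linearB /= qE jv subrr.
    by rewrite freeNil_nilpotent => ->.
  case=> j Jj jz; exists j => //; apply/freeNil_proj_eq0.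
  by rewrite linearB /= jz subrr.
have p_pred : p.-1.+1 = p by rewrite prednK.
pose i0 : 'I_n := Ordinal (ltnW n_gt1); pose i1 : 'I_n := Ordinal n_gt1.
have isotropic a b x y :
    metab_map a b x = (1, 0, 0) -> metab_map a b y = (0, 1, 0) ->
    (metab_map a b Y).2`_0 = 0 -> False.
  move=> xE yE Y0; apply: (isotropic_one_relator (m := p.-1) xE yE Y2 Y0) => z.
  by rewrite p_pred; exact: covered.
have [n_gt2|n_le2] := ltnP 2 n.
  have [] := @rank3_isotropic k n i0 i1 (Ordinal n_gt2) Y => // a [b] [x] [y].
  by case; exact: isotropic.
have all_i (i : 'I_n) : i = i0 \/ i = i1.
  have := ltn_ord i; case: i => [[|[|i]] ?] /= ?; [left|right|lia];
    exact: val_inj.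
pose a (i : 'I_n) : k := (i == i0)%:R; pose b (i : 'I_n) : k := (i == i1)%:R.
have [Y0|Yn0] := eqVneq ((metab_map a b Y).2`_0) 0.
  apply: (isotropic a b (free_gen k i0) (free_gen k i1)) Y0;
    by rewrite metab_map_gen.
(* Two generators and a nonzero constant term: [Y] spans [lcs L 2] modulo
   [lcs L 3], and it dies in [g]. *)
have p_gt1 : (1 < p)%N.
  rewrite ltn_neqAle p_gt0 andbT eq_sym; apply: contraNneq Yn0 => p1.
  by rewrite Yp // linear0 coef0.
apply: (lcs2_neq_lcs3 p_gt1) => w.
pose P : L -> g := pi \o freeNil_proj p.
have P_lie : lie_morph (pi \o freeNil_proj p).
  by move=> x y; rewrite /= freeNil_proj_lie pi_lie.
have P_onto y : exists x, (pi \o freeNil_proj p) x = y.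
  have [u <-] := onto_lfun pi_onto y; have [x ->] := freeNil_projP u.
  by exists x.
move=> /(lcs_onto P_lie P_onto)[z Lz <-].
have [s] := @rank2_relator k n i0 i1 isT all_i Y Y2 Yn0 z Lz.
move=> /(lcs_morph P_lie); rewrite linearB linearZ /= YX.
suff -> : pi X = 0 by rewrite scaler0 subr0.
have : [set` lker pi] X by rewrite N_gen; apply: sub_gen_smallest.
by rewrite /= memv_ker => /eqP.
Qed.

End OneRelatorQuotient.

Lemma rank_gt1 (k : fieldType) (g : finLieType k) n p
    (pi : 'Hom(freeNil k n p, g)) :
    limg pi = fullv -> nilpotent_class g p -> \dim {:g} <> 1%N -> (1 < n)%N.
Proof.
move=> pi_onto [_ gp _] dim_g; rewrite ltnNge; apply/negP => n_le1; apply: gp.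
have [z zE] := low_rank_line k n_le1.
have : (fullv <= <[pi (freeNil_proj p z)]>)%VS.
  apply/subvP => y _; have [u <-] := onto_lfun pi_onto y.
  have [x ->] := freeNil_projP u; have [a ->] := zE x.
  by rewrite !linearZ memvZ ?memv_line.
move=> /dimvS; rewrite dim_vline => dim_le.
have /eqP g0 : \dim {:g} == 0%N by move: dim_le dim_g; case: eqP => _ /=; lia.
apply/lcs0P => x _; apply/eqP; rewrite -memv0.
by move/eqP: g0; rewrite dimv_eq0 => /eqP <-; rewrite memvf.
Qed.

Theorem corollary1p8 (k : fieldType) (g : finLieType k) (n p : nat)
    (N : {vspace freeNil k n p}) (pi : 'Hom(freeNil k n p, g))
    (g_class : nilpotent_class g p) (ext_g : free_nil_extension N pi) :
  (has_central_extension g p.+1 <->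
     (dim_quot N (lie_vprod fullv N) < b2 g)%N) /\
  (\dim {:g} <> 1%N ->
   (exists2 X, X \in lie_vprod fullv (fullv : {vspace freeNil k n p}) &
      [set` N] = ideal_gen [set X]) ->
   has_central_extension g p.+1).
Proof.
case: (g_class) => p_gt0 _ g_nil.
case: ext_g => _ [pi_lie kerN pi_onto] N_sub.
have [q [q_lie qE q_onto]] := freeNil_truncation k n p.
have rho_lie : lie_morph (pi \o q)%VF.
  by move=> x y; rewrite !comp_lfunE q_lie pi_lie.
have rho_onto : limg (pi \o q)%VF = fullv by rewrite limg_comp q_onto.
have criterion := central_extension_criterion p_gt0 rho_lie rho_onto.
split; last first.
  move=> dim_g [X /mem_lcs2 X2 N_gen]; apply/criterion.
  apply: (one_relator_uncovered pi_lie pi_onto X2 _ g_class _ q_lie qE).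
    by rewrite kerN.
  exact: rank_gt1 pi_onto g_class dim_g.
pose R := lker (pi \o q)%VF.
have qR : (q @: R = N)%VS.
  rewrite -kerN; apply/vspaceP => u; apply/memv_imgP/idP.
    by case=> x; rewrite memv_ker comp_lfunE -memv_ker => Nx ->.
  have [x <-] := onto_lfun q_onto u => Nx; exists x => //.
  by rewrite memv_ker comp_lfunE -memv_ker.
have ker_q : (lker q <= R)%VS.
  by apply/subvP => x; rewrite !memv_ker comp_lfunE => /eqP ->; rewrite linear0.
have R_sub : (R <= lie_vprod fullv fullv)%VS.
  apply/subvP => u Ru; apply/mem_lcs2.
  have /(subvP N_sub)/mem_lcs2 : q u \in N by rewrite -qR memv_img.
  move=> /(lcs_onto q_lie (onto_lfun q_onto))[v Kv vu].
  have : u - v \in lker q by rewrite memv_ker linearB /= vu subrr.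
  move=> /(lker_truncation _ q_lie qE)/(lcs_le (i := 1)) uv.
  by rewrite -(subrK v u); apply: (submodD (submod_lcs _ 2)) => //; exact: uv.
have -> : b2 g = dim_quot R (lie_vprod fullv R).
  by apply: hopf_formula => // w; exact: cocycle_ext_lift.
rewrite -qR -{1}q_onto -lie_vprod_img //.
rewrite dim_quot_img_lt ?lie_vprod_lker //.
rewrite criterion; split=> nsub sub; apply: nsub.
  move=> u /(lker_truncation _ q_lie qE); exact: subvP.
apply/subvP => u /(lker_truncation _ q_lie qE); exact: sub.
Qed.
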